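(* (i) For every uniformly highly computable sequence $(G_e)_{e\in\mathbb{N}}$ of connected, locally finite multigraphs, the set $\{e\in\mathbb{N}: G_e \text{ admits a two-way infinite Eulerian path}\}$ is $\Pi_2^0$. (ii) There is a uniformly highly computable sequence $(G_e)_{e\in\mathbb{N}}$ of connected, locally finite multigraphs for which this set is $\Pi_2^0$-complete. That is, deciding whether a highly computable graph admits a two-way Eulerian path is $\Pi_2^0$-complete.
   Context: Multigraphs are undirected, may have loops and multiple edges; the degree of a vertex is the number of incident edges, loops counted twice. A multigraph $G$ is highly computable if $V(G)$ is a decidable subset of $\mathbb{N}$, the function $(u,v)\mapsto$ (number of edges joining $u,v$) is computable, $G$ is locally finite, and the degree function is computable. A sequence $(G_e)$ is uniformly highly computable if these data are computable uniformly in $e$. A two-way infinite Eulerian path is a sequence $(v_n)_{n\in\mathbb{Z}}$ of vertices with edges $e_n$ joining $v_n,v_{n+1}$ such that every edge of $G$ equals $e_n$ for exactly one $n\in\mathbb{Z}$. $\Pi_2^0$-complete means $\Pi_2^0$ and every $\Pi_2^0$ set is many-one reducible to it. *)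

(* Defs.v *)
From mathcomp Require Import all_boot all_order all_algebra.
From mathcomp Require Import mathcomp_extra boolp classical_sets functions cardinality.

Set Implicit Arguments.
Unset Strict Implicit.
Unset Printing Implicit Defensive.

Local Open Scope classical_set_scope.
Local Open Scope card_scope.

(* Programs for the partial recursive functions.  Arities are not tracked in   *)
(* the type: a program applied to an argument list on which it is ill-formed   *)
(* simply has no value.                                                        *)
Inductive recfun : Type :=
| RZero
| RSucc
| RProj (i : nat)
| RComp (f : recfun) (gs : seq recfun)
| RRec (f g : recfun)
| RMin (f : recfun).

(* [eval p s y]: the program p halts on the arguments s with value y.          *)
Inductive eval : recfun -> seq nat -> nat -> Prop :=
| EvalZero s : eval RZero s 0
| EvalSucc x : eval RSucc [:: x] x.+1
| EvalProj i s : i < size s -> eval (RProj i) s (nth 0 s i)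
| EvalComp f gs s ys y :
    size ys = size gs ->
    (forall i, i < size gs -> eval (nth RZero gs i) s (nth 0 ys i)) ->
    eval f ys y ->
    eval (RComp f gs) s y
| EvalRec0 f g s y :
    eval f s y ->
    eval (RRec f g) (0 :: s) y
| EvalRecS f g n s z y :
    eval (RRec f g) (n :: s) z ->
    eval g [:: n, z & s] y ->
    eval (RRec f g) (n.+1 :: s) y
(* All values below the minimizer must be defined and nonzero; the function t  *)
(* lists their predecessors.                                                   *)
| EvalMin f s n (t : nat -> nat) :
    (forall i, i < n -> eval f (i :: s) (t i).+1) ->
    eval f (n :: s) 0 ->
    eval (RMin f) s n.

Definition computable1 (f : nat -> nat) : Prop :=
  exists p, forall x, eval p [:: x] (f x).

Definition computable2 (f : nat -> nat -> nat) : Prop :=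
  exists p, forall x y, eval p [:: x; y] (f x y).

Definition computable3 (f : nat -> nat -> nat -> nat) : Prop :=
  exists p, forall x y z, eval p [:: x; y; z] (f x y z).

Definition pi02 (A : set nat) : Prop :=
  exists R : nat -> nat -> nat -> bool,
    computable3 (fun n x y => nat_of_bool (R n x y)) /\
    forall n, A n <-> forall x, exists y, R n x y.

Definition many_one_reducible (A B : set nat) : Prop :=
  exists f : nat -> nat, computable1 f /\ forall n, A n <-> B (f n).

Definition pi02_complete (A : set nat) : Prop :=
  pi02 A /\ forall B : set nat, pi02 B -> many_one_reducible B A.

(* The order of the two components of [ends x] is irrelevant: edges are only   *)
(* used through [joins], which is symmetric.                                   *)
Record multigraph : Type := Multigraph {
  vert : set nat;
  edge : Type;
  ends : edge -> nat * nat;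
  ends_vert : forall x, vert (ends x).1 /\ vert (ends x).2
}.

Definition joins (G : multigraph) (x : edge G) (u v : nat) : Prop :=
  ends x = (u, v) \/ ends x = (v, u).

Definition edges_between (G : multigraph) (u v : nat) : set (edge G) :=
  [set x | joins x u v].

Definition loops_at (G : multigraph) (v : nat) : set (edge G) :=
  [set x | joins x v v].

Definition links_at (G : multigraph) (v : nat) : set (edge G) :=
  [set x | exists2 u, u <> v & joins x u v].

Arguments edges_between : clear implicits.
Arguments loops_at : clear implicits.
Arguments links_at : clear implicits.

Definition has_degree (G : multigraph) (v d : nat) : Prop :=
  exists a b : nat, [/\ links_at G v #= `I_a, loops_at G v #= `I_b & d = a + 2 * b].

Definition locally_finite (G : multigraph) : Prop :=
  forall v, vert G v -> finite_set (links_at G v `|` loops_at G v).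

Definition graph_connected (G : multigraph) : Prop :=
  forall u v, vert G u -> vert G v ->
    exists (n : nat) (w : nat -> nat),
      [/\ w 0 = u, w n = v &
          forall i, i < n -> exists x : edge G, joins x (w i) (w i.+1)].

Definition uniformly_highly_computable (G : nat -> multigraph) : Prop :=
  [/\ exists V : nat -> nat -> bool,
        computable2 (fun e v => nat_of_bool (V e v)) /\
        (forall e v, vert (G e) v <-> V e v),
      exists m : nat -> nat -> nat -> nat,
        computable3 m /\
        (forall e u v, vert (G e) u -> vert (G e) v ->
           edges_between (G e) u v #= `I_(m e u v)),
      forall e, locally_finite (G e) &
      exists d : nat -> nat -> nat,
        computable2 d /\
        (forall e v, vert (G e) v -> has_degree (G e) v (d e v))].

Definition has_two_way_eulerian_path (G : multigraph) : Prop :=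
  exists (v : int -> nat) (x : int -> edge G),
    (forall n : int, joins (x n) (v n) (v (n + 1)%R)) /\
    (forall y : edge G, exists! n : int, x n = y).

(* Main.v *)
Require Import Defs.
From mathcomp Require Import all_boot all_order all_algebra.
From mathcomp Require Import mathcomp_extra boolp classical_sets functions cardinality.
From mathcomp Require Import zify.

Set Implicit Arguments.
Unset Strict Implicit.
Unset Printing Implicit Defensive.

(* Call a finite trail from a to b extensible if a and b both have an unused edge and every vertex
   of the trail with an unused edge is joined, outside the trail, to a or b.  This is a Sigma01
   condition in a highly computable graph, and a two-way Eulerian path exists iff every finite set
   of edges is covered by an extensible trail.  Necessity: take windows of the path.  For
   sufficiency, let T be extensible and U an extensible trail containing T, its escape routes and
   the next edges to be covered.  Contracting T to one virtual edge turns U into a finite connected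
   graph with the same odd vertices, whose Eulerian trail, with T put back, is an extensible trail
   that extends T on both sides; iterate.

   For completeness, take a comb in which every edge is doubled and the x-th hair grows until a z
   with R(e,x,z) is found, R being a universal relation for Pi02 sets.  If all hairs are finite,
   the closed trails around finite parts of the comb are extensible; an infinite hair is separated
   from the infinite rest by a cut of two edges, which no two-way Eulerian path allows.  The
   relation R checks lists of evaluation judgements, each derived from earlier ones, so that it
   needs bounded quantifiers only. *)

(** * Computable functions *)

(** The escape routes exclude this by finite data, so infinite components never enter the criterion.
    The remaining difficulty is that the trails supplied for larger and larger finite sets are
    unrelated: U may run through the edges of T in another order. U therefore serves only as a stock
    of edges with the right parities, from which a trail with factor T is rebuilt.

    In the comb, doubling makes all degrees even and gives a trail that enters a hair a second edge
    for coming back. It also makes the attachment of a hair an even cut, so both infinite ends of a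
    two-way path lie on the same side of it. *)

(** [X] is a type of environments and [vs] lists the variables read off them. A binder pairs the
    environment with a number, so the closure lemmas below also apply under bounded quantifiers and
    recursion. *)
Definition computes (X : Type) (vs : seq (X -> nat)) (f : X -> nat) : Prop :=
  exists p, forall x, eval p [seq v x | v <- vs] (f x).

Section Closure.
Variables (X : Type) (vs : seq (X -> nat)).

Lemma computes_ext (f g : X -> nat) : f =1 g -> computes vs f -> computes vs g.
Proof. by move=> e [p Hp]; exists p => x; rewrite -e. Qed.

Lemma computes_var i : i < size vs -> computes vs (nth (fun=> 0) vs i).
Proof.
move=> lti; exists (RProj i) => x.
have := @EvalProj i [seq v x | v <- vs]; rewrite size_map => /(_ lti).
by rewrite (nth_map (fun=> 0)).
Qed.

(** Substitution along a change of environment [h]; weakening is the case in which [h] is a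
    projection. *)
Lemma computes_comp (Y : Type) (ws : seq (Y -> nat)) (h : X -> Y) (f : Y -> nat) :
  computes ws f -> (forall i, i < size ws -> computes vs (fun x => nth (fun=> 0) ws i (h x))) ->
  computes vs (fun x => f (h x)).
Proof.
move=> [p Hp] Hws.
have {Hws} [gs [sz Hgs]] : exists gs, size gs = size ws /\ forall i, i < size gs ->
    forall x, eval (nth RZero gs i) [seq v x | v <- vs] (nth (fun=> 0) ws i (h x)).
  elim: ws Hws {p Hp} => [|w ws IH] Hws; first by exists [::].
  have [|gs [sz Hgs]] := IH; first by move=> i Hi; exact: (Hws i.+1 Hi).
  have [q Hq] := Hws 0 isT.
  by exists (q :: gs); split; [rewrite /= sz | case => [_ x|i Hi x]; [exact: Hq | exact: Hgs]].
exists (RComp p gs) => x; apply: (@EvalComp _ _ _ [seq w (h x) | w <- ws]) => //.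
- by rewrite size_map sz.
- by move=> i Hi; rewrite (nth_map (fun=> 0)) -?sz //; exact: Hgs.
Qed.

Lemma computes1 (g : nat -> nat) f :
  computable1 g -> computes vs f -> computes vs (fun x => g (f x)).
Proof.
move=> [p Hp] Hf; apply: (@computes_comp _ [:: id] f g); first by exists p.
by case.
Qed.

Lemma computes2 (g : nat -> nat -> nat) f1 f2 :
  computable2 g -> computes vs f1 -> computes vs f2 -> computes vs (fun x => g (f1 x) (f2 x)).
Proof.
move=> [p Hp] H1 H2.
apply: (@computes_comp _ [:: fst; snd] (fun x => (f1 x, f2 x)) (fun y => g y.1 y.2)).
  by exists p => x; exact: Hp.
by case=> [|[|]].
Qed.

Lemma computes3 (g : nat -> nat -> nat -> nat) f1 f2 f3 :
  computable3 g -> computes vs f1 -> computes vs f2 -> computes vs f3 ->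
  computes vs (fun x => g (f1 x) (f2 x) (f3 x)).
Proof.
move=> [p Hp] H1 H2 H3.
apply: (@computes_comp _ [:: (fun y => y.1.1); (fun y => y.1.2); snd]
  (fun x => (f1 x, f2 x, f3 x)) (fun y => g y.1.1 y.1.2 y.2)).
  by exists p => x; exact: Hp.
by case=> [|[|[|]]].
Qed.

Lemma computesS f : computes vs f -> computes vs (fun x => (f x).+1).
Proof. by apply: computes1; exists RSucc => x; exact: EvalSucc. Qed.

Lemma computes_const c : computes vs (fun=> c).
Proof.
elim: c => [|c IH]; last exact: computesS.
by exists RZero => x; exact: EvalZero.
Qed.

(** The step function sees the counter, the accumulated value and then the old variables, which is
    the order in which [EvalRecS] passes its arguments. *)
Lemma computes_rec (b n : X -> nat) (g : X -> nat -> nat -> nat) :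
  computes vs b -> computes vs n ->
  computes [:: (fun q : X * nat * nat => q.1.2), snd & [seq v \o (fst \o fst) | v <- vs]]
    (fun q : X * nat * nat => g q.1.1 q.1.2 q.2) ->
  computes vs (fun x => nat_rect _ (b x) (g x) (n x)).
Proof.
move=> [pb Hb] Hn [pg Hg].
apply: (@computes_comp _ (snd :: [seq v \o fst | v <- vs]) (fun x => (x, n x))
  (fun q : X * nat => nat_rect (fun=> nat) (b q.1) (g q.1) q.2)).
  exists (RRec pb pg) => -[x m] /=; rewrite -map_comp.
  elim: m => [|m IH] /=; first exact/EvalRec0/Hb.
  apply: EvalRecS; first exact: IH.
  have := Hg ((x, m), nat_rect _ (b x) (g x) m) => /=.
  by rewrite -map_comp.
case=> [|i] //=; rewrite size_map => Hi; rewrite (nth_map (fun=> 0)) //=.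
exact: computes_var.
Qed.

Lemma computes_mu (P : X -> nat -> bool) (f : X -> nat) :
  computes (snd :: [seq v \o fst | v <- vs]) (fun q : X * nat => nat_of_bool (~~ P q.1 q.2)) ->
  (forall x, P x (f x)) -> (forall x i, i < f x -> ~~ P x i) ->
  computes vs f.
Proof.
(* [RMin] searches for the value 0, hence the negation in the hypothesis. Before the hit the value
   is always 1, with predecessor 0. *)
move=> [p Hp] H1 H2; exists (RMin p) => x; apply: (@EvalMin _ _ _ (fun=> 0)) => [i lti|].
  have := Hp (x, i) => /=.
  by rewrite -map_comp (H2 _ _ lti).
have := Hp (x, f x) => /=.
by rewrite -map_comp H1.
Qed.
End Closure.

(** * Bounded quantifiers, bounded sums and arithmetic *)

Definition ball n (P : nat -> bool) := all P (iota 0 n).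
Definition bex n (P : nat -> bool) := has P (iota 0 n).
Definition bsum n (F : nat -> nat) := \sum_(i < n) F i.

Lemma ballP n (P : nat -> bool) : reflect (forall i, i < n -> P i) (ball n P).
Proof.
apply: (iffP allP) => H i; first by move=> lti; apply: H; rewrite mem_iota.
by rewrite mem_iota => /andP[_]; apply: H.
Qed.

Lemma ballS n (P : nat -> bool) : ball n.+1 P = ball n P && P n.
Proof. by rewrite /ball -addn1 iotaD all_cat /= andbT. Qed.

Lemma bexP n (P : nat -> bool) : reflect (exists2 i, i < n & P i) (bex n P).
Proof.
by apply: (iffP hasP) => -[i lti Pi]; exists i => //; move: lti; rewrite mem_iota.
Qed.

Lemma computes_add X (vs : seq (X -> nat)) f g :
  computes vs f -> computes vs g -> computes vs (fun x => f x + g x).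
Proof.
move=> Hf Hg; apply: (@computes_ext _ _ (fun x => nat_rect (fun=> nat) (f x) (fun _ => S) (g x))).
  by move=> x; elim: (g x) => [|n IH] /=; rewrite ?addn0 // IH addnS.
by apply: computes_rec => //; apply: computesS; exact: (@computes_var _ _ 1).
Qed.

Lemma computes_pred X (vs : seq (X -> nat)) f : computes vs f -> computes vs (fun x => (f x).-1).
Proof.
move=> Hf; apply: (@computes_ext _ _ (fun x => nat_rect (fun=> nat) 0 (fun n _ => n) (f x))).
  by move=> x; case: (f x).
apply: computes_rec => //; first exact: computes_const.
exact: (@computes_var _ _ 0).
Qed.

Lemma computes_sub X (vs : seq (X -> nat)) f g :
  computes vs f -> computes vs g -> computes vs (fun x => f x - g x).
Proof.
move=> Hf Hg; apply: (@computes_ext _ _ (fun x => nat_rect (fun=> nat) (f x) (fun _ => predn) (g x))).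
  by move=> x; elim: (g x) => [|n IH] /=; rewrite ?subn0 // IH subnS.
by apply: computes_rec => //; apply: computes_pred; exact: (@computes_var _ _ 1).
Qed.

Lemma computes_mul X (vs : seq (X -> nat)) f g :
  computes vs f -> computes vs g -> computes vs (fun x => f x * g x).
Proof.
move=> Hf Hg; apply: (@computes_ext _ _ (fun x => nat_rect (fun=> nat) 0 (fun _ a => f x + a) (g x))).
  by move=> x; elim: (g x) => [|n IH] /=; rewrite ?muln0 // IH mulnS.
apply: computes_rec => //; first exact: computes_const.
apply: computes_add; last exact: (@computes_var _ _ 1).
apply: (@computes_comp _ _ _ vs (fun q => q.1.1)) => // i lti.
have := (@computes_var _ [:: (fun q : X * nat * nat => q.1.2), snd & [seq v \o (fst \o fst) | v <- vs]] i.+2) => /=.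
by rewrite size_map (nth_map (fun=> 0)) //; apply.
Qed.

Lemma computes_negb X (vs : seq (X -> nat)) (P : X -> bool) :
  computes vs P -> computes vs (fun x => nat_of_bool (~~ P x)).
Proof.
move=> HP; apply: (@computes_ext _ _ (fun x => 1 - P x)); first by move=> x; case: (P x).
by apply: computes_sub => //; exact: computes_const.
Qed.

Lemma computes_andb X (vs : seq (X -> nat)) (P Q : X -> bool) :
  computes vs P -> computes vs Q -> computes vs (fun x => nat_of_bool (P x && Q x)).
Proof.
move=> HP HQ; apply: (@computes_ext _ _ (fun x => P x * Q x)); last exact: computes_mul.
by move=> x; case: (P x); case: (Q x).
Qed.

Lemma computes_orb X (vs : seq (X -> nat)) (P Q : X -> bool) :
  computes vs P -> computes vs Q -> computes vs (fun x => nat_of_bool (P x || Q x)).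
Proof.
move=> HP HQ; apply: (@computes_ext _ _ (fun x => nat_of_bool (~~ (~~ P x && ~~ Q x)))).
  by move=> x; case: (P x); case: (Q x).
by apply/computes_negb/computes_andb; exact: computes_negb.
Qed.

Lemma computes_implyb X (vs : seq (X -> nat)) (P Q : X -> bool) :
  computes vs P -> computes vs Q -> computes vs (fun x => nat_of_bool (P x ==> Q x)).
Proof.
move=> HP HQ; apply: (@computes_ext _ _ (fun x => nat_of_bool (~~ P x || Q x))).
  by move=> x; case: (P x).
by apply: computes_orb => //; exact: computes_negb.
Qed.

Lemma computes_leq X (vs : seq (X -> nat)) f g :
  computes vs f -> computes vs g -> computes vs (fun x => nat_of_bool (f x <= g x)).
Proof.
move=> Hf Hg; apply: (@computes_ext _ _ (fun x => 1 - (f x - g x))).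
  by move=> x; rewrite /leq; case: (f x - g x).
by apply: computes_sub; [exact: computes_const | exact: computes_sub].
Qed.

Lemma computes_eqn X (vs : seq (X -> nat)) f g :
  computes vs f -> computes vs g -> computes vs (fun x => nat_of_bool (f x == g x)).
Proof.
move=> Hf Hg; apply: (@computes_ext _ _ (fun x => nat_of_bool ((f x <= g x) && (g x <= f x)))).
  by move=> x; rewrite -eqn_leq.
by apply: computes_andb; exact: computes_leq.
Qed.

Lemma computes_eqb X (vs : seq (X -> nat)) (P Q : X -> bool) :
  computes vs P -> computes vs Q -> computes vs (fun x => nat_of_bool (P x == Q x)).
Proof.
move=> HP HQ; apply: (@computes_ext _ _ (fun x => nat_of_bool (nat_of_bool (P x) == Q x))).
  by move=> x; case: (P x); case: (Q x).
exact: computes_eqn.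
Qed.

Lemma computes_if X (vs : seq (X -> nat)) (P : X -> bool) f g :
  computes vs P -> computes vs f -> computes vs g -> computes vs (fun x => if P x then f x else g x).
Proof.
move=> HP Hf Hg; apply: (@computes_ext _ _ (fun x => P x * f x + ~~ P x * g x)).
  by move=> x; case: (P x); rewrite ?mul1n ?mul0n ?addn0.
by apply: computes_add; apply: computes_mul => //; exact: computes_negb.
Qed.

Lemma computes_iter X (vs : seq (X -> nat)) (n f : X -> nat) (g : X -> nat -> nat) :
  computes vs n -> computes vs f ->
  computes (snd :: [seq v \o fst | v <- vs]) (fun q : X * nat => g q.1 q.2) ->
  computes vs (fun x => iter (n x) (g x) (f x)).
Proof.
move=> Hn Hf Hg; apply: (@computes_rec _ _ f n (fun x _ => g x)) => //.
apply: (@computes_comp _ _ _ _ (fun q => (q.1.1, q.2)) _ Hg) => -[_|i].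
  exact: (@computes_var _ _ 1).
rewrite /= size_map => lti; rewrite (nth_map (fun=> 0)) //=.
have := (@computes_var _ [:: (fun q : X * nat * nat => q.1.2), snd & [seq v \o (fst \o fst) | v <- vs]] i.+2) => /=.
by rewrite size_map (nth_map (fun=> 0)) //; apply.
Qed.

Lemma computes_bsum X (vs : seq (X -> nat)) n (F : X -> nat -> nat) :
  computes vs n -> computes (snd :: [seq v \o fst | v <- vs]) (fun q : X * nat => F q.1 q.2) ->
  computes vs (fun x => bsum (n x) (F x)).
Proof.
move=> Hn HF; apply: (@computes_ext _ _ (fun x => nat_rect (fun=> nat) 0 (fun i a => a + F x i) (n x))).
  rewrite /bsum => x; elim: (n x) => [|i IH] /=; first by rewrite big_ord0.
  by rewrite big_ord_recr /= IH.
apply: computes_rec => //; first exact: computes_const.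
apply: computes_add; first exact: (@computes_var _ _ 1).
apply: (@computes_comp _ _ _ _ (fun q => q.1) _ HF) => -[_|i].
  exact: (@computes_var _ _ 0).
rewrite /= size_map => lti; rewrite (nth_map (fun=> 0)) //=.
have := (@computes_var _ [:: (fun q : X * nat * nat => q.1.2), snd & [seq v \o (fst \o fst) | v <- vs]] i.+2) => /=.
by rewrite size_map (nth_map (fun=> 0)) //; apply.
Qed.

Lemma computes_ball X (vs : seq (X -> nat)) n (P : X -> nat -> bool) :
  computes vs n ->
  computes (snd :: [seq v \o fst | v <- vs]) (fun q : X * nat => nat_of_bool (P q.1 q.2)) ->
  computes vs (fun x => nat_of_bool (ball (n x) (P x))).
Proof.
move=> Hn HP; apply: (@computes_ext _ _ (fun x => nat_of_bool (bsum (n x) (fun i => ~~ P x i) == 0))).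
  move=> x; congr nat_of_bool; rewrite /bsum sum_nat_eq0; apply/forallP/ballP => H i.
    by move=> lti; have := H (Ordinal lti); case: (P x i).
  by rewrite H.
apply: computes_eqn; last exact: computes_const.
by apply: (@computes_bsum _ _ n (fun x i => nat_of_bool (~~ P x i))) => //; exact: computes_negb.
Qed.

Lemma computes_bex X (vs : seq (X -> nat)) n (P : X -> nat -> bool) :
  computes vs n ->
  computes (snd :: [seq v \o fst | v <- vs]) (fun q : X * nat => nat_of_bool (P q.1 q.2)) ->
  computes vs (fun x => nat_of_bool (bex (n x) (P x))).
Proof.
move=> Hn HP; apply: (@computes_ext _ _ (fun x => nat_of_bool (~~ ball (n x) (fun i => ~~ P x i)))).
  by move=> x; rewrite /ball /bex -has_predC; congr nat_of_bool; apply: eq_has => i /=; rewrite negbK.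
by apply/computes_negb/computes_ball => //; exact: computes_negb.
Qed.

(** A hook, rebound once the coding functions are known to be computable, so that they are then
    treated as primitives. *)
Ltac computes_named := fail.

Ltac computes_step :=
  cbn [map]; cbv beta;
  first
  [ lazymatch goal with |- computes ?vs _ => first
      [ exact (@computes_var _ vs 0 isT) | exact (@computes_var _ vs 1 isT)
      | exact (@computes_var _ vs 2 isT) | exact (@computes_var _ vs 3 isT)
      | exact (@computes_var _ vs 4 isT) | exact (@computes_var _ vs 5 isT)
      | exact (@computes_var _ vs 6 isT) | exact (@computes_var _ vs 7 isT) ] end
  | lazymatch goal with
    | |- computes _ (fun _ => ?c) => exact: computes_const
    | |- computes _ (fun x => S (@?f x)) => apply: (@computesS _ _ f)
    | |- computes _ (fun x => predn (@?f x)) => apply: (@computes_pred _ _ f)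
    | |- computes _ (fun x => addn (@?f x) (@?g x)) => apply: (@computes_add _ _ f g)
    | |- computes _ (fun x => muln (@?f x) (@?g x)) => apply: (@computes_mul _ _ f g)
    | |- computes _ (fun x => subn (@?f x) (@?g x)) => apply: (@computes_sub _ _ f g)
    | |- computes _ (fun x => if _ then _ else _) => apply: computes_if
    | |- computes _ (fun x => iter (@?n x) (@?g x) (@?f x)) => apply: (@computes_iter _ _ n f g)
    | |- computes _ (fun x => bsum (@?n x) (@?g x)) => apply: (@computes_bsum _ _ n g)
    | |- computes _ (fun x => nat_of_bool (ball (@?n x) (@?g x))) => apply: (@computes_ball _ _ n g)
    | |- computes _ (fun x => nat_of_bool (bex (@?n x) (@?g x))) => apply: (@computes_bex _ _ n g)
    | |- computes _ (fun x => nat_of_bool (negb (@?f x))) => apply: (@computes_negb _ _ f)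
    | |- computes _ (fun x => nat_of_bool (andb (@?f x) (@?g x))) => apply: (@computes_andb _ _ f g)
    | |- computes _ (fun x => nat_of_bool (orb (@?f x) (@?g x))) => apply: (@computes_orb _ _ f g)
    | |- computes _ (fun x => nat_of_bool (implb (@?f x) (@?g x))) => apply: (@computes_implyb _ _ f g)
    | |- computes _ (fun x => nat_of_bool (leq (@?f x) (@?g x))) => apply: (@computes_leq _ _ f g)
    | |- computes _ (fun x => nat_of_bool (eq_op (@?f x) (@?g x))) =>
        first [apply: (@computes_eqn _ _ f g) | apply: (@computes_eqb _ _ f g)]
    end
  | match goal with
    | H : computable1 ?g |- computes _ (fun x => ?g (@?f1 x)) => apply: (@computes1 _ _ g f1 H)
    | H : computable2 ?g |- computes _ (fun x => ?g (@?f1 x) (@?f2 x)) =>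
        apply: (@computes2 _ _ g f1 f2 H)
    | H : computable2 _ |- computes _ (fun x => nat_of_bool (?g (@?f1 x) (@?f2 x))) =>
        apply: (@computes2 _ _ (fun e v => nat_of_bool (g e v)) f1 f2 H)
    | H : computable3 ?g |- computes _ (fun x => ?g (@?f1 x) (@?f2 x) (@?f3 x)) =>
        apply: (@computes3 _ _ g f1 f2 f3 H)
    | H : computable3 _ |- computes _ (fun x => nat_of_bool (?g (@?f1 x) (@?f2 x) (@?f3 x))) =>
        apply: (@computes3 _ _ (fun e v w => nat_of_bool (g e v w)) f1 f2 f3 H)
    end
  | computes_named | eassumption ].
Ltac computes_tac := repeat computes_step.

Lemma computable1P (g : nat -> nat) : computes [:: id] g -> computable1 g.
Proof. by case=> p Hp; exists p. Qed.

Lemma computable2P (g : nat -> nat -> nat) :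
  computes [:: fst; snd] (fun q => g q.1 q.2) -> computable2 g.
Proof. by case=> p Hp; exists p => x y; exact: (Hp (x, y)). Qed.

Lemma computable3P (g : nat -> nat -> nat -> nat) :
  computes [:: (fun q => q.1.1); (fun q => q.1.2); snd] (fun q => g q.1.1 q.1.2 q.2) ->
  computable3 g.
Proof. by case=> p Hp; exists p => x y z; exact: (Hp (x, y, z)). Qed.

(** * Coding of pairs and sequences *)

(* [cpair] is injective but not surjective: [cfst] and [csnd] vanish outside its range. *)
Definition cpair a b := (a + b) * (a + b) + a.
Definition cfst c := bsum c.+1 (fun a => bsum c.+1 (fun b => a * (cpair a b == c))).
Definition csnd c := bsum c.+1 (fun a => bsum c.+1 (fun b => b * (cpair a b == c))).

(** The code lies in the interval from [(a + b)^2] to just below [(a + b + 1)^2]; it therefore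
    determines [a + b], and then [a]. *)
Lemma cpair_inj a b a' b' : cpair a b = cpair a' b' -> a = a' /\ b = b'.
Proof.
rewrite /cpair => H; have e : a + b = a' + b' by nia.
by move: H; rewrite e; lia.
Qed.

Lemma cpair_eqE a b a' b' : (cpair a b == cpair a' b') = (a == a') && (b == b').
Proof.
apply/eqP/andP => [/cpair_inj[-> ->] // | [/eqP-> /eqP->] //].
Qed.

Lemma leq_cpair a b a' b' : a <= a' -> b <= b' -> cpair a b <= cpair a' b'.
Proof. by move=> Ha Hb; rewrite /cpair; apply: leq_add => //; apply: leq_mul; apply: leq_add. Qed.

Lemma leq_cpairl a b : a <= cpair a b.
Proof. by rewrite /cpair leq_addl. Qed.

Lemma leq_cpairr a b : b <= cpair a b.
Proof. by rewrite /cpair; nia. Qed.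

Lemma bsum_cpair (F : nat -> nat -> nat) a b :
  bsum (cpair a b).+1 (fun x => bsum (cpair a b).+1 (fun y => F x y * (cpair x y == cpair a b))) = F a b.
Proof.
have Ha : a < (cpair a b).+1 by rewrite ltnS leq_cpairl.
have Hb : b < (cpair a b).+1 by rewrite ltnS leq_cpairr.
rewrite /bsum (bigD1 (Ordinal Ha)) //= [X in _ + X]big1 ?addn0 => [|i /eqP Hi].
  rewrite (bigD1 (Ordinal Hb)) //= [X in _ + X]big1 ?addn0 ?eqxx ?muln1 // => i /eqP Hi.
  rewrite cpair_eqE eqxx /=; case: eqP => [e|_]; last by rewrite muln0.
  by case: Hi; apply: val_inj.
apply: big1 => j _; rewrite cpair_eqE; case: eqP => [e|_]; last by rewrite muln0.
by case: Hi; apply: val_inj.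
Qed.

Lemma cfstK a b : cfst (cpair a b) = a.
Proof. exact: (@bsum_cpair (fun x _ => x)). Qed.

Lemma csndK a b : csnd (cpair a b) = b.
Proof. exact: (@bsum_cpair (fun _ y => y)). Qed.

Lemma computes_cpair X (vs : seq (X -> nat)) f g :
  computes vs f -> computes vs g -> computes vs (fun x => cpair (f x) (g x)).
Proof. by rewrite /cpair => Hf Hg; computes_tac. Qed.

Lemma computable_cfst : computable1 cfst.
Proof. by apply: computable1P; rewrite /cfst /cpair; computes_tac. Qed.

Lemma computable_csnd : computable1 csnd.
Proof. by apply: computable1P; rewrite /csnd /cpair; computes_tac. Qed.

Definition elem c i := cfst (iter i csnd c).
(** Since [cpair 0 0 = 0], trailing zeros are invisible and the length cannot be recovered; it is
    stored separately wherever it matters. *)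
Definition enc (s : seq nat) := foldr cpair 0 s.

Lemma csnd0 : csnd 0 = 0.
Proof. exact: (csndK 0 0). Qed.

Lemma elem_enc s i : elem (enc s) i = nth 0 s i.
Proof.
rewrite /elem; elim: s i => [|x s IH] i.
  rewrite nth_nil (_ : iter i csnd (enc [::]) = 0) ?(cfstK 0 0) //.
  by elim: i => //= i ->; exact: csnd0.
case: i => [|i]; first exact: cfstK.
by rewrite iterSr [enc _]/= csndK IH.
Qed.

Lemma computable_elem : computable2 elem.
Proof.
apply: computable2P; rewrite /elem; have := (computable_cfst, computable_csnd) => -[H1 H2].
by computes_tac.
Qed.

Ltac computes_named ::=
  lazymatch goal with
  | |- computes _ (fun x => cpair (@?f x) (@?g x)) => apply: (@computes_cpair _ _ f g)
  | |- computes _ (fun x => cfst (@?f x)) => apply: (@computes1 _ _ cfst f computable_cfst)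
  | |- computes _ (fun x => csnd (@?f x)) => apply: (@computes1 _ _ csnd f computable_csnd)
  | |- computes _ (fun x => elem (@?f x) (@?g x)) => apply: (@computes2 _ _ elem f g computable_elem)
  end.

(** * Walks and finite Eulerian trails *)

Section Walks.
Variables l r : nat -> nat.
Implicit Types (c f u v w : nat) (p q F : seq nat).

Definition incident c u := (l c == u) || (r c == u).
Definition other_end c u := if l c == u then r c else l c.
(** A walk is a start and a list of edges. The direction in which an edge is used is recovered from
    the current vertex, so it is not stored. *)
Fixpoint is_walk u p := if p is c :: p' then incident c u && is_walk (other_end c u) p' else true.
Definition walk_end u p := foldl (fun v c => other_end c v) u p.
Definition degree p w := \sum_(c <- p) ((l c == w) + (r c == w)).

Local Notation inc := incident.
Local Notation oth := other_end.
Local Notation walk := is_walk.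
Local Notation dst := walk_end.
Local Notation deg := degree.

Lemma inc_oth c u : inc c u -> inc c (oth c u).
Proof. by rewrite /incident /other_end; case: eqP => _ //=; rewrite eqxx ?orbT. Qed.

Lemma othK c u : inc c u -> oth c (oth c u) = u.
Proof.
rewrite /incident /other_end; case: (eqVneq (l c) u) => [<- _|_ /= /eqP <-]; last by rewrite eqxx.
by case: eqP.
Qed.

Lemma inc_or c u v : inc c u -> inc c v -> v = u \/ v = oth c u.
Proof.
rewrite /incident /other_end => /orP[] /eqP <- /orP[] /eqP <-; rewrite ?eqxx; auto.
by case: eqP; auto.
Qed.

Lemma walk_cat u p q : walk u (p ++ q) = walk u p && walk (dst u p) q.
Proof. by elim: p u => //= c p IH u; rewrite IH andbA. Qed.

Lemma dst_cat u p q : dst u (p ++ q) = dst (dst u p) q.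
Proof. exact: foldl_cat. Qed.

Lemma walk_rev u p : walk u p -> walk (dst u p) (rev p) /\ dst (dst u p) (rev p) = u.
Proof.
elim: p u => //= c p IH u /andP[icu /IH[H1 H2]]; rewrite rev_cons -cats1 walk_cat dst_cat /=.
by rewrite H1 H2 inc_oth //= othK.
Qed.

Lemma walk_visits u p f w : walk u p -> f \in p -> inc f w ->
  exists p' q', p = p' ++ q' /\ dst u p' = w.
Proof.
move=> wp fp; case/path.splitPr: fp wp => q1 q2; rewrite walk_cat => /andP[_ /= /andP[i1 _]] i2.
have [->|->] := inc_or i1 i2; first by exists q1, (f :: q2).
by exists (rcons q1 f), q2; rewrite cat_rcons -cats1 dst_cat.
Qed.

Lemma deg_cat p q w : deg (p ++ q) w = deg p w + deg q w.
Proof. by rewrite /degree big_cat. Qed.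

(** Each step changes the parity at its two ends, and the contributions at inner visits cancel. *)
Lemma odd_deg_walk u p w : walk u p -> odd (deg p w) = (u == w) (+) (dst u p == w).
Proof.
elim: p u => [|c p IH] u /=; first by rewrite /degree big_nil addbb.
move=> /andP[icu /IH]; rewrite /degree big_cons !oddD => ->; rewrite addbA; congr (_ (+) _).
move: icu; rewrite /incident /other_end; case: (eqVneq (l c) u) => [<- _ | neq /= /eqP <-] /=.
  by case: (l c == w); case: (r c == w).
by case: (l c == w); case: (r c == w).
Qed.

Lemma maximal_trail F u : uniq F ->
  exists p, [/\ uniq p, {subset p <= F}, walk u p
    & forall c, c \in F -> inc c (dst u p) -> c \in p].
Proof.
have [n] := ubnP (size F); elim: n F u => // n IH F u ltF uF.
case: (boolP (has (inc^~ u) F)) => [/hasP[c cF icu]|/hasPn H]; last first.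
  by exists [::]; split=> // c /H; rewrite /= => /negbTE ->.
have [||p [up sp wp Hp]] := IH (rem c F) (oth c u).
- by rewrite size_rem //; case: F cF ltF {uF}.
- exact: rem_uniq.
exists (c :: p); split=> [||/=|c' c'F /= ic].
- by rewrite /= up andbT; apply/negP => /sp; rewrite mem_rem_uniq // inE eqxx.
- by move=> x; rewrite inE => /orP[/eqP-> //|/sp]; rewrite mem_rem_uniq // => /andP[].
- by rewrite icu wp.
- rewrite inE; case: eqP => //= /eqP ne; apply: Hp => //.
  by rewrite mem_rem_uniq // inE ne c'F.
Qed.

Lemma deg_sub F p w : uniq F -> uniq p -> {subset p <= F} ->
  deg F w = deg p w + deg [seq f <- F | f \notin p] w.
Proof.
move=> uF up sp; rewrite -deg_cat /degree; apply: perm_big; apply: uniq_perm => //.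
  rewrite cat_uniq up filter_uniq // andbT; apply/hasPn => x.
  by rewrite mem_filter => /andP[].
move=> x; rewrite mem_cat mem_filter; case: (boolP (x \in p)) => [/sp -> //|_].
by rewrite /=.
Qed.

(** No edge of [F] is left at the end of [p], so [F] and [p] have the same degree there; comparing
    the two parity formulas identifies this end as [v]. *)
Lemma maximal_trail_end F u v p : uniq F -> uniq p -> {subset p <= F} -> walk u p ->
  (forall c, c \in F -> inc c (dst u p) -> c \in p) ->
  (forall w, odd (deg F w) = (u == w) (+) (v == w)) -> dst u p = v.
Proof.
move=> uF up sp wp Hp /(_ (dst u p)); rewrite (deg_sub _ uF up sp) oddD (odd_deg_walk _ wp) eqxx.
rewrite [deg [seq _ <- _ | _] _]big1_seq ?addbF; last first.
  move=> c /andP[_]; rewrite mem_filter => /andP[cp cF].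
  have := contra (Hp c cF) cp; rewrite /incident negb_or.
  by case: eqP => //= _; case: eqP.
by move/addbI; case: eqP.
Qed.

(** Connectivity stated through closed vertex sets instead of paths: it can be applied directly to
    the set of vertices met by a partial trail, and it ignores vertices without edges. *)
Definition connected_from F c := forall S : pred nat, S c ->
  (forall f, f \in F -> S (l f) = S (r f)) -> forall f, f \in F -> S (l f).

Theorem euler_trail F c d : uniq F -> connected_from F c ->
  (forall w, odd (deg F w) = (c == w) (+) (d == w)) ->
  exists p, [/\ perm_eq p F, walk c p & dst c p = d].
Proof.
move=> uF conn oddF.
suff grow n p : size F - size p < n -> uniq p -> {subset p <= F} -> walk c p -> dst c p = d ->
    exists p, [/\ perm_eq p F, walk c p & dst c p = d].
  have [p [up sp wp Hp]] := maximal_trail c uF.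
  exact: (grow _ p (ltnSn _)) up sp wp (maximal_trail_end uF up sp wp Hp oddF).
elim: n p => // n IH p ltn up sp wp dp.
case: (boolP (all (mem p) F)) => [/allP sF|].
  by exists p; split=> //; apply: uniq_perm => // x; apply/idP/idP => [/sp|/sF].
rewrite -has_predC => /hasP[f0 f0F /= f0p].
pose F' := [seq f <- F | f \notin p].
pose S w := (w == c) || has (inc^~ w) p.
have [f [fF' Sf]] : exists f, f \in F' /\ (S (l f) || S (r f)).
  apply: contrapT => nex.
  have nS f : f \in F' -> ~~ (S (l f) || S (r f)) by move=> ?; apply/negP => ?; apply: nex; exists f.
  have f0F' : f0 \in F' by rewrite mem_filter f0p.
  have /negP := nS _ f0F'; apply; apply/orP; left.
  apply: (conn S) => //; first by rewrite /S eqxx.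
  move=> f fF; case: (boolP (f \in p)) => fp.
    by rewrite /S; apply/idP/idP => _; apply/orP; right; apply/hasP; exists f; rewrite // /incident eqxx ?orbT.
  have := nS f; rewrite mem_filter fp fF => /(_ isT); rewrite negb_or.
  by case: (S (l f)); case: (S (r f)).
have [w [ifw Sw]] : exists w, inc f w /\ S w.
  by case/orP: Sf => ?; [exists (l f) | exists (r f)]; rewrite /incident eqxx ?orbT.
have [p' [q' [ep dw]]] : exists p' q', p = p' ++ q' /\ dst c p' = w.
  case/orP: Sw => [/eqP ->|/hasP[g gp /= igw]]; first by exists [::], p.
  exact: walk_visits wp gp igw.
have uF' : uniq F' by rewrite filter_uniq.
have [q [uq sq wq Hq]] := maximal_trail w uF'.
have dq : dst w q = w.
  apply: (maximal_trail_end uF' uq sq wq Hq) => x; rewrite addbb.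
  have := oddF x; rewrite (deg_sub _ uF up sp) oddD (odd_deg_walk _ wp) dp.
  by rewrite -[RHS]addbF => /addbI.
have fq : f \in q by apply: Hq; rewrite ?dq.
have sqF x : x \in q -> (x \in F) && (x \notin p) by move/sq; rewrite mem_filter andbC.
have pe : perm_eq (p' ++ q ++ q') (p ++ q) by rewrite ep -catA perm_cat2l perm_catC.
have upq : uniq (p ++ q).
  rewrite cat_uniq up uq andbT /=; apply/hasPn => x /sqF /andP[_ ]//.
apply: (IH (p' ++ q ++ q')).
- rewrite (perm_size pe) size_cat.
  have : size (p ++ q) <= size F.
    apply: uniq_leq_size => // x; rewrite mem_cat => /orP[/sp //|/sqF /andP[]//].
  have : 0 < size q by case: (q) fq.
  by rewrite size_cat; move: ltn; clear; move: (size F) (size p) (size q) => *; lia.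
- by rewrite (perm_uniq pe).
- by move=> x; rewrite (perm_mem pe) mem_cat => /orP[/sp //|/sqF /andP[]//].
- by move: wp; rewrite ep !walk_cat dw dq wq => /andP[-> ->].
- by move: dp; rewrite ep !dst_cat dw dq.
Qed.

Lemma walk_inv (S : pred nat) u p : walk u p -> (forall f, f \in p -> S (l f) = S (r f)) ->
  S u = S (dst u p).
Proof.
elim: p u => //= c p IH u /andP[icu wp] H; rewrite -IH //; last first.
  by move=> f fp; apply: H; rewrite inE fp orbT.
have := H c; rewrite inE eqxx => /(_ isT).
by move: icu; rewrite /incident /other_end; case: eqP => [<- //|_ /= /eqP <-].
Qed.
End Walks.

Lemma bounded_choice (I : eqType) (s : seq I) (P : I -> nat -> Prop) :
  (forall i m n, m <= n -> P i m -> P i n) -> (forall i, i \in s -> exists n, P i n) ->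
  exists n, forall i, i \in s -> P i n.
Proof.
move=> mono; elim: s => [|i s IH] H; first by exists 0.
have [|n Hn] := IH; first by move=> j js; apply: H; rewrite inE js orbT.
have [m Hm] := H i (mem_head _ _).
exists (maxn m n) => j; rewrite inE => /orP[/eqP-> | js].
  exact: mono (leq_maxl _ _) Hm.
exact: mono (leq_maxr _ _) (Hn j js).
Qed.

(** * Extensible trails *)

Section Extensible.
Variables (l r : nat -> nat) (E : pred nat).
Implicit Types (c f u v w : nat) (p q F : seq nat).

Notation inc := (incident l r).
Notation oth := (other_end l r).
Notation walk := (is_walk l r).
Notation dst := (walk_end l r).
Notation deg := (degree l r).

Definition unsat p w := exists f, [/\ E f, inc f w & f \notin p].

(** A walk with repetitions is allowed: escape routes serve only to prove connectivity. *)
Definition escapes p a b w :=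
  exists q, [/\ walk w q, all E q, forall g, g \in q -> g \notin p & dst w q = a \/ dst w q = b].

Definition extensible a p :=
  [/\ p != [::], [&& walk a p, all E p & uniq p], unsat p a, unsat p (dst a p)
    & forall f w, f \in p -> inc f w -> unsat p w -> escapes p a (dst a p) w].

Definition exhausted :=
  forall N, exists a p, extensible a p /\ forall c, c < N -> E c -> c \in p.

Definition edge_bound (B : nat -> nat) := forall w c, E c -> inc c w -> c < B w.

Lemma unsatS p p' w : {subset p <= p'} -> unsat p' w -> unsat p w.
Proof. by move=> sp [f [Ef ifw fp]]; exists f; split=> //; apply: contra fp; exact: sp. Qed.

(** Extensibility depends only on the set of edges and the unordered pair of ends, so a trail may be
    rearranged or reversed. *)
Lemma extensible_perm a p a' p' : extensible a p -> perm_eq p' p -> walk a' p' ->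
  (a' = a /\ dst a' p' = dst a p) \/ (a' = dst a p /\ dst a' p' = a) -> extensible a' p'.
Proof.
move=> [np /and3P[wp Ep up] ua ub H] pe wp' ends.
have un w : unsat p w -> unsat p' w by apply: unsatS => x; rewrite (perm_mem pe).
have nu w : unsat p' w -> unsat p w by apply: unsatS => x; rewrite (perm_mem pe).
split.
- by apply: contra np => /eqP e; move: pe; rewrite e perm_sym => /perm_nilP ->.
- by rewrite wp' (perm_all _ pe) Ep (perm_uniq pe).
- by apply: un; case: ends => -[-> _].
- by apply: un; case: ends => -[_ ->].
- move=> f w; rewrite (perm_mem pe) => fp ifw /nu uw; have [q [wq Eq dq eq]] := H f w fp ifw uw.
  exists q; split=> //; first by move=> g /dq; rewrite (perm_mem pe).
  by case: ends => -[-> ->]; case: eq; auto.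
Qed.

(* The trail [p] from [a] to [b] is contracted, inside the larger trail [u], to one virtual edge
   (which takes over the code of the first edge of [p]).  The resulting finite graph is connected
   since [u] contains the escape routes of [p], so it has an Eulerian trail with the ends of [u];
   expanding the virtual edge rearranges [u] into a trail that contains [p] as a factor. *)
Lemma rearrange a p c (u : seq nat) : extensible a p -> extensible c u -> {subset p <= u} ->
  (forall f w, f \in p -> inc f w -> unsat p w ->
     exists q, [/\ walk w q, {subset q <= u}, forall g, g \in q -> g \notin p
       & dst w q = a \/ dst w q = dst a p]) ->
  exists a' x y, [/\ extensible a' (x ++ p ++ y), perm_eq (x ++ p ++ y) u, dst a' x = a
    & (a' = c /\ dst a' (x ++ p ++ y) = dst c u) \/ (a' = dst c u /\ dst a' (x ++ p ++ y) = c)].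
Proof.
move=> gp gu spu esc.
have [np /and3P[wp Ep up] ua ub _] := gp.
have [nu /and3P[wu Eu uu] uc ud _] := gu.
set b := dst a p in ub esc *; set d := dst c u in ud *.
case Ep0 : p np => [//|t p0] _; rewrite -Ep0.
have tp : t \in p by rewrite Ep0 mem_head.
pose l' x := if x == t then a else l x.
pose r' x := if x == t then b else r x.
pose Fu := [seq f <- u | f \notin p].
pose F := t :: Fu.
have tFu : t \notin Fu by rewrite mem_filter tp.
have uFu : uniq Fu by rewrite filter_uniq.
have uF : uniq F by rewrite /= tFu.
have netFu f : f \in Fu -> (f == t) = false.
  by move=> fF; apply/negbTE; apply: contra tFu => /eqP <-.
have oddF w : odd (degree l' r' F w) = (c == w) (+) (d == w).
  (* The virtual edge from [a] to [b] contributes the same parities as the trail [p] that it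
     replaces. *)
  have -> : degree l' r' F w = (a == w) + (b == w) + deg Fu w.
    rewrite /degree big_cons {1}/l' {1}/r' eqxx; congr (_ + _).
    by apply: eq_big_seq => f /netFu; rewrite /l' /r' => ->.
  rewrite -(odd_deg_walk _ wu) (deg_sub _ _ _ uu up spu) !oddD (odd_deg_walk _ wp).
  by rewrite !oddb.
have conn : connected_from l' r' F c.
  move=> S Sc clo.
  have Sab : S a = S b by have := clo t (mem_head _ _); rewrite /l' /r' eqxx.
  have cloFu f : f \in Fu -> S (l f) = S (r f).
    by move=> fF; have := clo f; rewrite inE fF orbT /l' /r' netFu //; apply.
  have onp f w : f \in p -> inc f w -> unsat p w -> S w = S a.
    move=> fp ifw uw; have [q [wq sq dq eq]] := esc f w fp ifw uw.
    have -> : S w = S (dst w q).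
      apply: (walk_inv wq) => g gq; apply: cloFu; rewrite mem_filter dq //; exact: sq.
    by case: eq => ->.
  have fwd v s f : walk v s -> {subset s <= u} -> f \in s -> f \in p -> unsat p v -> S v = S a.
    elim: s v => [//|g s IH] v /= /andP[igv ws] su fs fp uv.
    have gu' : g \in u by apply: su; rewrite mem_head.
    case: (boolP (g \in p)) => gpp; first exact: onp gpp igv uv.
    have -> : S v = S (oth g v).
      apply: (@walk_inv l r S v [:: g]) => /=; first by rewrite igv.
      by move=> h; rewrite inE => /eqP ->; apply: cloFu; rewrite mem_filter gpp.
    apply: IH => //.
    - by move=> h hs; apply: su; rewrite inE hs orbT.
    - by move: fs; rewrite inE => /orP[/eqP e|//]; move: gpp; rewrite -e fp.
    - exists g; split=> //; [exact: (allP Eu) | exact: inc_oth].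
  (* The edge [t] of [p] occurs on [u] either before or after the visit to [w]; [u] is followed
     backwards or forwards accordingly. *)
  have onu f w : f \in u -> inc f w -> unsat p w -> S w = S a.
    move=> fu ifw uw; have [p' [q' [eu dw]]] := walk_visits wu fu ifw.
    have := spu t tp; rewrite {1}eu mem_cat => /orP[tl|tr].
      have := wu; rewrite eu walk_cat => /andP[wp' _].
      have [wr dr] := walk_rev wp'.
      apply: (fwd w (rev p') t) => //; first by rewrite -dw.
        by move=> x; rewrite mem_rev eu mem_cat => ->.
      by rewrite mem_rev.
    apply: (fwd w q' t) => //; first by move: wu; rewrite eu walk_cat dw => /andP[].
    by move=> x xq; rewrite eu mem_cat xq orbT.
  have Sca : S c = S a.
    have ucp : unsat p c by apply: unsatS uc.
    case Eu0 : u nu => [//|g u0] _; apply: (onu g) => //; first by rewrite Eu0 mem_head.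
    by move: wu; rewrite Eu0 => /= /andP[].
  move=> f; rewrite inE => /orP[/eqP ->|fF]; first by rewrite /l' eqxx -Sca.
  rewrite /l' netFu //; move: (fF); rewrite mem_filter => /andP[fp fu].
  rewrite (onu f) -?Sca //; first by rewrite /incident eqxx.
  by exists f; split=> //; [exact: (allP Eu) | rewrite /incident eqxx].
have [s [ps ws ds]] := euler_trail uF conn oddF.
have ts : t \in s by rewrite (perm_mem ps) mem_head.
case/path.splitPr: ts ps ws ds => x y ps.
have pxy : perm_eq (x ++ y) Fu.
  by move: ps; rewrite -cat1s perm_catCA perm_cons.
have agree z v : {subset z <= Fu} -> is_walk l' r' v z = walk v z /\ walk_end l' r' v z = dst v z.
  elim: z v => [//|f z IH] v sz /=.
  have /netFu nf : f \in Fu by apply: sz; rewrite mem_head.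
  have io : (incident l' r' f v = inc f v) * (other_end l' r' f v = oth f v).
    by rewrite /incident /other_end /l' /r' nf.
  rewrite !io; have [|-> ->//] := IH (oth f v).
  by move=> g gz; apply: sz; rewrite inE gz orbT.
have sx : {subset x <= Fu} by move=> z zx; rewrite -(perm_mem pxy) mem_cat zx.
have sy : {subset y <= Fu} by move=> z zy; rewrite -(perm_mem pxy) mem_cat zy orbT.
have [ax bx] := agree x c sx; have agy v := agree y v sy.
rewrite walk_cat dst_cat /= ax bx (agy _).1 (agy _).2.
set w := dst c x => /and3P[wx itw wy] dy.
have pe z : perm_eq z p -> perm_eq (x ++ z ++ y) u.
  move=> pz; rewrite perm_catCA; apply: (@perm_trans _ (p ++ Fu)).
    by apply: perm_cat.
  apply: uniq_perm => //.
    rewrite cat_uniq up uFu andbT; apply/hasPn => g.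
    by rewrite mem_filter => /andP[].
  move=> g; rewrite mem_cat mem_filter.
  by case: (boolP (g \in p)) => [/spu -> //|].
(* The virtual edge may be traversed from [b] to [a]. In that case the whole trail is reversed, so
   that [p] itself appears and not its reverse. *)
have [ewa|ewb] : (w = a /\ other_end l' r' t w = b) \/ (w = b /\ other_end l' r' t w = a).
  move: itw; rewrite /incident /other_end /l' /r' eqxx.
  by case: (eqVneq a w) => [<- _|_ /= /eqP <-]; auto.
- move: ewa wy dy => [ewa ->] wy dy; exists c, x, y.
  have wk : walk c (x ++ p ++ y) by rewrite !walk_cat -/w wx ewa wp -/b.
  have dk : dst c (x ++ p ++ y) = d by rewrite !dst_cat -/w ewa.
  by split; auto; apply: (extensible_perm gu); auto.
- move: ewb wy dy => [ewb ->] wy dy; exists d, (rev y), (rev x).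
  have [wrp drp] := walk_rev wp.
  have wk : walk c (x ++ rev p ++ y) by rewrite !walk_cat -/w wx ewb -/b wrp drp.
  have dk : dst c (x ++ rev p ++ y) = d by rewrite !dst_cat -/w ewb -/b drp.
  have pk : perm_eq (rev y ++ p ++ rev x) u.
    apply: perm_trans (pe (rev p) _); last by rewrite perm_rev.
    rewrite -[in X in perm_eq X _](revK p) -rev_cat -rev_cat -catA perm_rev.
    by [].
  have [] := walk_rev wk; rewrite dk !rev_cat revK -catA => wk' dk'.
  have dry : dst d (rev y) = a by have [_] := walk_rev wy; rewrite dy.
  by split; auto; apply: (extensible_perm gu); auto.
Qed.

Lemma extend B a p N : edge_bound B -> exhausted -> extensible a p ->
  exists a' x y, [/\ extensible a' (x ++ p ++ y), x != [::], y != [::], dst a' x = a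
    & forall c, c < N -> E c -> c \in x ++ p ++ y].
Proof.
move=> EB exh gp; have [np /and3P[wp Ep up] ua ub H] := gp.
pose Q f n := forall w, inc f w -> unsat p w ->
  exists q, [/\ walk w q, all E q, all (ltn^~ n) q, forall g, g \in q -> g \notin p
       & dst w q = a \/ dst w q = dst a p].
have bd (q : seq nat) : exists n, all (ltn^~ n) q.
  have [i m n lemn ltm|i _|n Hn] := @bounded_choice _ q (fun i n => i < n).
  - exact: leq_trans ltm lemn.
  - by exists i.+1.
  by exists n; apply/allP.
have [|f fp|n Hn] := @bounded_choice _ p Q.
- move=> f m n lemn Hm w ifw uw; have [q [? ? qm ? ?]] := Hm w ifw uw; exists q; split=> //.
  by apply: sub_all qm => g ltg; exact: leq_trans ltg lemn.
- have one w : exists n, inc f w -> unsat p w ->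
    exists q, [/\ walk w q, all E q, all (ltn^~ n) q, forall g, g \in q -> g \notin p
       & dst w q = a \/ dst w q = dst a p].
    case: (pselect (inc f w /\ unsat p w)) => [[ifw uw]|nw].
      by have [q [? ? ? ?]] := H f w fp ifw uw; have [n Hn] := bd q; exists n => _ _; exists q.
    by exists 0 => ? ?; case: nw.
  have [n1 H1] := one (l f); have [n2 H2] := one (r f).
  exists (maxn n1 n2) => w /orP[] /eqP <- uw.
    have [|//|q [? ? qm ? ?]] := H1; first by rewrite /incident eqxx.
    by exists q; split=> //; apply: sub_all qm => g /= ltg; apply: leq_trans ltg (leq_maxl _ _).
  have [|//|q [? ? qm ? ?]] := H2; first by rewrite /incident eqxx orbT.
  by exists q; split=> //; apply: sub_all qm => g /= ltg; apply: leq_trans ltg (leq_maxr _ _).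
have [n0 Hn0] := bd p.
(* The summands account for the requested edges, the escape routes, the edges of [p], and all edges
   at its two ends. *)
pose M := N + n + n0 + B a + B (dst a p).
have [c [u [gu cov]]] := exh M.
have spu : {subset p <= u}.
  move=> f fp; apply: cov; last exact: (allP Ep).
  by have /= := allP Hn0 f fp; rewrite /M; clear; lia.
have satu w f : w = a \/ w = dst a p -> E f -> inc f w -> f \in u.
  move=> ew Ef ifw; apply: cov => //; have := EB _ _ Ef ifw.
  by rewrite /M; case: ew => ->; clear; lia.
have nunsat w : w = a \/ w = dst a p -> ~ unsat u w.
  by move=> ew [f [Ef ifw /negP]]; apply; exact: satu ew Ef ifw.
have [|a' [x [y [g' pe da ends]]]] := rearrange gp gu spu.
  move=> f w fp ifw uw; have [q [wq Eq qn dq eq]] := Hn f fp w ifw uw.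
  exists q; split=> // g gq; apply: cov; last exact: (allP Eq).
  by have /= := allP qn g gq; rewrite /M; clear; lia.
have nun w : w = a \/ w = dst a p -> ~ unsat (x ++ p ++ y) w.
  move=> ew uw; apply: (nunsat w ew); apply: unsatS uw => z.
  by rewrite (perm_mem pe).
have [_ _ ua' ub' _] := g'.
exists a', x, y; split=> //.
- by apply/eqP => ex; apply: (nun a'); auto; left; rewrite -da ex.
- apply/eqP => ey; apply: (nun _ _ ub'); right.
  by rewrite !dst_cat da ey.
- move=> f ltf Ef; rewrite (perm_mem pe); apply: cov => //.
  by rewrite /M; move: ltf; clear; lia.
Qed.

(** * Two-way trails and their finite windows *)

Definition two_way_trail (v x : int -> nat) :=
  [/\ forall n, E (x n), forall n, inc (x n) (v n) /\ oth (x n) (v n) = v (n + 1)%R,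
      forall c, E c -> exists n, x n = c & injective x].

Fixpoint window (x : int -> nat) (s : int) k :=
  if k is k'.+1 then x s :: window x (s + 1)%R k' else [::].

Lemma mem_window x s k c : c \in window x s k -> exists2 i, i < k & c = x (s + i%:Z)%R.
Proof.
elim: k s => //= k IH s; rewrite inE => /orP[/eqP->|/IH[i lti ->]].
  by exists 0 => //; rewrite GRing.addr0.
by exists i.+1 => //; congr x; lia.
Qed.

Lemma in_window x s k i : i < k -> x (s + i%:Z)%R \in window x s k.
Proof.
elim: k s i => // k IH s [|i] lti /=; rewrite inE; first by rewrite GRing.addr0 eqxx.
apply/orP; right; rewrite (_ : s + i.+1%:Z = (s + 1) + i%:Z)%R; [exact: IH | lia].
Qed.

Section Window.
Variables v x : int -> nat.
Hypothesis tr : two_way_trail v x.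

Lemma walk_window s k : walk (v s) (window x s k) /\ dst (v s) (window x s k) = v (s + k%:Z)%R.
Proof.
have [_ H _ _] := tr; elim: k s => [|k IH] s /=; first by rewrite GRing.addr0.
have [-> ->] := H s; have [-> ->] := IH (s + 1)%R; split=> //; congr v; lia.
Qed.

Lemma all_window s k : all E (window x s k).
Proof. by have [H _ _ _] := tr; apply/allP => c /mem_window[i _ ->]. Qed.

Lemma uniq_window s k : uniq (window x s k).
Proof.
have [_ _ _ inj] := tr; elim: k s => //= k IH s; rewrite IH andbT.
by apply/negP => /mem_window[i _ /inj]; lia.
Qed.

(** An edge outside a window is traversed before or after it, and the path itself leads from there
    to the nearer end of the window without using its edges. *)
Lemma exhausted_of_two_way : exhausted.
Proof.
move=> N; have [HE Hst Hsur inj] := tr.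
have [c m n lemn H Ec|c _|M HM] := @bounded_choice _ (iota 0 N)
    (fun c M => E c -> exists n, x n = c /\ `|n|%N < M).
- by have [k [? ltk]] := H Ec; exists k; split=> //; exact: leq_trans ltk lemn.
- case: (boolP (E c)) => Ec; last by exists 0.
  by have [n Hn] := Hsur c Ec; exists `|n|%N.+1 => _; exists n.
pose s : int := (- (M.+1)%:Z)%R; pose k := (M.+1 + M.+1)%N.
have wi := walk_window s k.
have out n : ((n < s) || (s + k%:Z <= n))%R -> x n \notin window x s k.
  by move=> Hn; apply/negP => /mem_window[i lti /inj e]; move: Hn; rewrite e; lia.
have incS n : inc (x n) (v (n + 1)%R) by have [i <-] := Hst n; exact: inc_oth.
exists (v s), (window x s k); split; last first.
  move=> c ltc Ec; have [|//|n [<- ltn]] := HM c; first by rewrite mem_iota.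
  rewrite (_ : n = s + (`|n - s|%N)%:Z)%R; last by rewrite /s; lia.
  by apply: in_window; rewrite /k /s; lia.
split=> //.
- by rewrite wi.1 all_window uniq_window.
- exists (x (s - 1)%R); split=> //.
    by have := incS (s - 1)%R; rewrite GRing.subrK.
  by apply: out; lia.
- rewrite wi.2; exists (x (s + k%:Z)%R); split=> //; first exact: (Hst _).1.
  by apply: out; rewrite /k; lia.
- move=> f w _ _ [g [Eg igw gp]]; have [n en] := Hsur g Eg; rewrite -{g}en in Eg igw gp.
  rewrite wi.2.
  have [m ew nm] : exists2 m, w = v m & m = n \/ m = (n + 1)%R.
    have [i1 i2] := Hst n; have [->|->] := inc_or i1 igw; first by exists n; auto.
    by exists (n + 1)%R; auto.
  rewrite {w}ew in igw *; case: (boolP (n < s)%R) => [lens|lesn].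
    have lems : (m <= s)%R by case: nm => ->; lia.
    have em : (m + (`|s - m|%N)%:Z = s)%R by lia.
    have [w1 w2] := walk_window m `|s - m|%N; rewrite em in w2.
    exists (window x m `|s - m|%N); split; rewrite ?all_window //; last by left.
    by move=> h /mem_window[i lti ->]; apply: out; lia.
  have les : (s + k%:Z <= n)%R.
    apply: contraT => ltn; move/negP: gp; case.
    rewrite (_ : n = s + (`|n - s|%N)%:Z)%R; last by lia.
    by apply: in_window; lia.
  set s' := (s + k%:Z)%R in les *.
  have lems : (s' <= m)%R by case: nm => ->; lia.
  have em : (s' + (`|m - s'|%N)%:Z = m)%R by lia.
  have [/walk_rev[w1 w2] w3] := walk_window s' `|m - s'|%N; rewrite em in w3.
  rewrite w3 in w1 w2.
  exists (rev (window x s' `|m - s'|%N)); split; rewrite ?all_rev ?all_window //; last by right.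
  by move=> h; rewrite mem_rev => /mem_window[i lti ->]; apply: out; lia.
Qed.
End Window.

(** Iterating [extend] gives trails [p k], each a factor of the next. Index 0 is the first edge of
    [p 0], so index [n] sits at position [n + o k] of [p k], where [o k] counts the edges added on
    the left. Both sides grow at every stage, so stage [k] contains all indices with absolute value
    at most [k]. *)
Lemma two_way_of_exhausted B : edge_bound B -> exhausted -> exists v x : int -> nat, two_way_trail v x.
Proof.
move=> EB exh.
pose next (q : nat * (nat * seq nat)) (t : nat * seq nat * seq nat) :=
  extensible q.2.1 q.2.2 -> let p' := t.1.2 ++ q.2.2 ++ t.2 in
  [/\ extensible t.1.1 p', t.1.2 != [::], t.2 != [::], dst t.1.1 t.1.2 = q.2.1
    & forall c, c < q.1 -> E c -> c \in p'].
have [f Hf] : {f : nat * (nat * seq nat) -> nat * seq nat * seq nat & forall t, next t (f t)}.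
  apply: choice => -[N [a p]]; rewrite /next /=.
  case: (pselect (extensible a p)) => [gp|ng]; last by exists (0, [::], [::]).
  by have [a' [x [y H]]] := extend N EB exh gp; exists (a', x, y).
have [a0 [p0 [g0 _]]] := exh 0.
pose st := fix st k := if k is k'.+1 then
  let t := f (k, st k') in (t.1.1, t.1.2 ++ (st k').2 ++ t.2) else (a0, p0).
pose a k := (st k).1; pose p k := (st k).2.
pose X k := (f (k.+1, st k)).1.2; pose Y k := (f (k.+1, st k)).2.
have gk k : extensible (a k) (p k).
  by elim: k => //= k IH; have [] := Hf (k.+1, st k) IH.
have pS k : p k.+1 = X k ++ p k ++ Y k by [].
have stepk k := Hf (k.+1, st k) (gk k).
pose o k := \sum_(i < k) size (X i).
have oS k : o k.+1 = o k + size (X k) by rewrite /o big_ord_recr.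
have geo k : k <= o k.
  elim: k => // k IH; rewrite oS -addn1 leq_add // lt0n size_eq0.
  by have [_ ? _ _ _] := stepk k.
have gep k : k + o k < size (p k).
  elim: k => [|k IH]; first by rewrite /o big_ord0 lt0n size_eq0; have [] := gk 0.
  rewrite pS !size_cat oS; have [_ _ + _ _] := stepk k; rewrite -/(Y k) -size_eq0 => ny.
  by move: (size (X k)) (size (p k)) (size (Y k)) (o k) IH ny => *; lia.
(* Stage [k] reappears in stage [k + d], shifted by the number of edges added on the left in
   between. *)
have stab k d i : (i < size (p k) -> nth 0 (p (k + d)) (i + (o (k + d) - o k)) = nth 0 (p k) i) /\
    (i <= size (p k) -> dst (a (k + d)) (take (i + (o (k + d) - o k)) (p (k + d))) = dst (a k) (take i (p k))).
  suff main : forall d, exists x y, [/\ p (k + d) = x ++ p k ++ y, size x = o (k + d) - o k, o k <= o (k + d)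
      & dst (a (k + d)) x = a k].
    have [x [y [-> sx _ dx]]] := main d; rewrite -sx; split=> lei.
      by rewrite nth_cat ifF ?addnK ?nth_cat ?lei //; apply/negbTE; rewrite -leqNgt leq_addl.
    rewrite take_cat ifF ?addnK; last by apply/negbTE; rewrite -leqNgt leq_addl.
    by rewrite dst_cat dx takel_cat.
  elim=> [|d' [x [y [e sx leo dx]]]].
    by exists [::], [::]; rewrite addn0 subnn cats0.
  exists (X (k + d') ++ x), (y ++ Y (k + d')); rewrite addnS pS e oS; split.
  - by rewrite -!catA.
  - by rewrite size_cat sx; lia.
  - by lia.
  - by have [_ _ _ dX _] := stepk (k + d'); rewrite dst_cat dX.
(* For [k] at least the absolute value of [n] the integer inside is nonnegative, so taking its
   absolute value changes nothing. *)
pose pos k (n : int) := `|(n + (o k)%:Z)%R|%N.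
pose x n := nth 0 (p `|n|%N) (pos `|n|%N n).
pose v n := dst (a `|n|%N) (take (pos `|n|%N n) (p `|n|%N)).
have posE k n : `|n|%N <= k -> ((pos k n)%:Z = n + (o k)%:Z)%R.
  by move=> le; have := geo k; rewrite /pos; lia.
have posp k n : `|n|%N <= k -> pos k n < size (p k).
  by move=> le; have := posE k n le; have := gep k; move: (size (p k)) => *; lia.
have shift k n : `|n|%N <= k -> pos `|n|%N n + (o k - o `|n|%N) = pos k n.
  move=> le; have := posE k n le; have := posE `|n|%N n (leqnn _).
  have : o `|n|%N <= o k.
    by move: le; generalize (`|n|%N) => j /subnKC <-; elim: (k - j) => [|d IH]; rewrite ?addn0 // addnS oS; lia.
  by lia.
have xE k n : `|n|%N <= k -> x n = nth 0 (p k) (pos k n).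
  move=> le; have [H _] := stab `|n|%N (k - `|n|%N) (pos `|n|%N n).
  by rewrite /x -H ?posp // subnKC // shift.
have vE k n : `|n|%N <= k -> v n = dst (a k) (take (pos k n) (p k)).
  move=> le; have [_ H] := stab `|n|%N (k - `|n|%N) (pos `|n|%N n).
  by rewrite /v -H ?(ltnW (posp _ _ _)) // subnKC // shift.
exists v, x; split.
- move=> n; have [_ /and3P[_ /allP Ep _] _ _ _] := gk `|n|%N.
  by apply: Ep; rewrite mem_nth // posp.
- move=> n; set k := `|n|%N.+1.
  have le1 : `|n|%N <= k by rewrite /k; lia.
  have le2 : `|(n + 1)%R|%N <= k by rewrite /k; lia.
  rewrite (xE k) // !(vE k) //.
  have -> : pos k (n + 1)%R = (pos k n).+1 by have := posE k n le1; have := posE k _ le2; lia.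
  have lts := posp k n le1.
  have [_ /and3P[wp _ _] _ _ _] := gk k.
  move: wp; rewrite -{1}(cat_take_drop (pos k n) (p k)) (drop_nth 0) // walk_cat => /and3P[_ ink _].
  by rewrite (take_nth 0) // -cats1 dst_cat.
- move=> c Ec; set k := c.+1.
  have ck : c \in p k by have [_ _ _ _ H] := stepk c; apply: H.
  pose i := index c (p k); have lti : i < size (p k) by rewrite index_mem.
  pose n : int := (i%:Z - (o k)%:Z)%R; exists n.
  pose K := k + `|n|%N; rewrite (xE K); last by rewrite /K; lia.
  have [H _] := stab k `|n|%N i.
  rewrite -[RHS](nth_index 0 ck) -/i -H // -/K.
  congr nth; have leK : `|n|%N <= K by rewrite /K leq_addl.
  have leo : o k <= o K.
    by rewrite /K; elim: `|n|%N => [|d IH]; rewrite ?addn0 // addnS oS; lia.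
  by have := posE K n leK; move: leo; rewrite /n; clear; lia.
- move=> n m; set k := maxn `|n|%N `|m|%N.
  have le1 : `|n|%N <= k by rewrite leq_maxl.
  have le2 : `|m|%N <= k by rewrite leq_maxr.
  rewrite !(xE k) // => /eqP; have [_ /and3P[_ _ up] _ _ _] := gk k.
  rewrite nth_uniq ?posp // => /eqP e.
  by have := posE k n le1; have := posE k m le2; rewrite e; lia.
Qed.
End Extensible.

(** * Exhaustion by extensible trails is a Pi02 property *)

Section Checker.
Variables (E : nat -> nat -> bool) (B : nat -> nat -> nat) (l r : nat -> nat).
Hypotheses (cE : computable2 (fun e c => nat_of_bool (E e c))) (cB : computable2 B).
Hypotheses (cl : computable1 l) (cr : computable1 r).
Hypothesis EB : forall e, edge_bound l r (E e) (B e).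

Notation inc := (incident l r).
Notation oth := (other_end l r).
Notation walk := (is_walk l r).
Notation dst := (walk_end l r).

Definition vtx u cs j := nat_rect (fun=> nat) u (fun j v => oth (elem cs j) v) j.
Definition dec cs L := mkseq (elem cs) L.
Definition memc cs L c := bex L (fun j => elem cs j == c).
Definition walkc e u cs L := ball L (fun j => E e (elem cs j) && inc (elem cs j) (vtx u cs j)).
Definition satc e cs L w := ball (B e w) (fun c => (E e c && inc c w) ==> memc cs L c).
Definition escapesc e cs L a b w q :=
  [&& walkc e w (csnd q) (cfst q), ball (cfst q) (fun j => ~~ memc cs L (elem (csnd q) j))
    & (vtx w (csnd q) (cfst q) == a) || (vtx w (csnd q) (cfst q) == b)].

(* [y] codes the start of a trail, its length, its edges, and escape routes for the two ends of
   each of its edges. *)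
Definition checker e N y :=
  let a := elem y 0 in let L := elem y 1 in let cs := elem y 2 in let ws := elem y 3 in
  let b := vtx a cs L in
  [&& 0 < L, walkc e a cs L, ball L (fun j => ball j (fun i => elem cs i != elem cs j)),
      ~~ satc e cs L a, ~~ satc e cs L b, ball N (fun c => E e c ==> memc cs L c)
    & ball L (fun j =>
       (satc e cs L (l (elem cs j)) || escapesc e cs L a b (l (elem cs j)) (elem ws (j + j))) &&
       (satc e cs L (r (elem cs j)) || escapesc e cs L a b (r (elem cs j)) (elem ws (j + j).+1)))].

Lemma computable_vtx : computable3 vtx.
Proof.
apply: computable3P; rewrite /vtx /other_end; apply: computes_rec; computes_tac.
Qed.

Lemma computable_checker : computable3 (fun e N y => nat_of_bool (checker e N y)).
Proof.
have cv := computable_vtx.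
apply: computable3P; rewrite /checker /escapesc /satc /walkc /memc /incident.
by computes_tac.
Qed.

Lemma vtxE u cs j : vtx u cs j = dst u (dec cs j).
Proof.
elim: j => // j IH; rewrite /dec mkseqS -cats1 dst_cat /=.
by rewrite -/(dec cs j) -IH.
Qed.

Lemma memcE cs L c : memc cs L c = (c \in dec cs L).
Proof.
apply/bexP/mapP => -[j H1 H2]; exists j; rewrite ?mem_iota // ?(eqP H2) //.
  by move: H1; rewrite mem_iota.
by rewrite H2.
Qed.

Lemma walkcE e u cs L : walkc e u cs L = walk u (dec cs L) && all (E e) (dec cs L).
Proof.
rewrite /walkc; elim: L => [|L IH] //.
rewrite ballS IH.
rewrite /dec mkseqS -cats1 walk_cat all_cat /= !andbT vtxE.
by case: (walk _ _); case: (all _ _); case: (E _ _); case: (inc _ _).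
Qed.

(** The search in [satc] stops at [B e w]; by [EB] no edge at [w] lies beyond it. *)
Lemma unsatP e cs L w : reflect (unsat l r (E e) (dec cs L) w) (~~ satc e cs L w).
Proof.
apply: (iffP idP) => [|[f [Ef ifw nf]]].
  rewrite /satc /ball -has_predC => /hasP[c _ /=]; rewrite negb_imply memcE => /andP[/andP[? ?] ?].
  by exists c.
apply/negP => /ballP/(_ f (EB Ef ifw)); rewrite Ef ifw /= memcE.
by rewrite (negbTE nf).
Qed.

Lemma uniq_dec cs L : uniq (dec cs L) = ball L (fun j => ball j (fun i => elem cs i != elem cs j)).
Proof.
elim: L => [|L IH] //.
rewrite /dec mkseqS rcons_uniq IH andbC ballS; congr (_ && _); rewrite /ball.
rewrite -memcE /memc; apply: negb_inj; rewrite negbK -has_predC.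
by apply: eq_has => i /=; rewrite negbK.
Qed.

Lemma checkerP e N : (exists y, checker e N y) <->
  exists a p, extensible l r (E e) a p /\ forall c, c < N -> E e c -> c \in p.
Proof.
split=> [[y]|[a [p [[np /and3P[wp Ep up] ua ub H] cov]]]].
  rewrite /checker; set a := elem y 0; set L := elem y 1; set cs := elem y 2; set ws := elem y 3.
  rewrite vtxE walkcE => /and5P[L0 /andP[wp Ep] up ua /and3P[ub cov esc]].
  exists a, (dec cs L); split; last first.
    by move=> c ltc Ec; have /ballP/(_ c ltc) := cov; rewrite Ec memcE.
  split; rewrite ?wp ?Ep ?uniq_dec ?up //.
  - by rewrite -size_eq0 size_mkseq -lt0n.
  - exact/unsatP.
  - exact/unsatP.
  - move=> f w /mapP[j]; rewrite mem_iota add0n => /andP[_ ltj] -> iw uw.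
    have escP q : escapesc e cs L a (dst a (dec cs L)) w q ->
        escapes l r (E e) (dec cs L) a (dst a (dec cs L)) w.
      rewrite /escapesc walkcE vtxE => /and3P[/andP[wq Eq] /ballP dq eq].
      exists (dec (csnd q) (cfst q)); split=> //.
        move=> g /mapP[i]; rewrite mem_iota add0n => /andP[_ lti] ->.
        by have := dq i lti; rewrite memcE.
      by case/orP: eq => /eqP; auto.
    move/ballP: esc => /(_ j ltj) /andP[].
    case/orP: iw => /eqP e1; rewrite e1; move/unsatP: uw => /negbTE -> /=.
      by move/escP.
    by move=> _ /escP.
pose b := dst a p.
(* Indices [2j] and [2j + 1] stand for the left and right end of the [j]-th edge, matching [j + j]
   and [(j + j).+1] in [checker]. *)
pose wi i := if odd i then r (nth 0 p i./2) else l (nth 0 p i./2).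
pose Q i q := i./2 < size p -> unsat l r (E e) p (wi i) ->
  escapesc e (enc p) (size p) a b (wi i) q.
have [q Hq] : {q : nat -> nat & forall i, Q i (q i)}.
  apply: choice => i; rewrite /Q; set w := wi i.
  case: (pselect (i./2 < size p /\ unsat l r (E e) p w)) => [[lti uw]|nn]; last first.
    by exists 0 => ? ?; case: nn.
  have [|q [wq Eq dq eq]] := H (nth 0 p i./2) w (mem_nth _ lti) _ uw.
    by rewrite /w /wi /incident; case: (odd i); rewrite eqxx ?orbT.
  exists (cpair (size q) (enc q)) => _ _; rewrite /escapesc cfstK csndK walkcE vtxE.
  have eqd s : dec (enc s) (size s) = s.
    by rewrite /dec (eq_mkseq (elem_enc s)) mkseq_nth.
  rewrite eqd wq Eq /=; apply/andP; split.
    by apply/ballP => j ltj; rewrite memcE eqd elem_enc dq // mem_nth.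
  by case: eq => ->; rewrite eqxx ?orbT.
have eqd s : dec (enc s) (size s) = s.
  by rewrite /dec (eq_mkseq (elem_enc s)) mkseq_nth.
exists (enc [:: a; size p; enc p; enc (mkseq q (size p + size p))]).
rewrite /checker !elem_enc /= vtxE walkcE eqd wp Ep /=.
have eun w : satc e (enc p) (size p) w || (~~ satc e (enc p) (size p) w) by case: satc.
apply/and5P; split.
- by rewrite lt0n size_eq0.
- by rewrite -uniq_dec eqd.
- by apply/unsatP; rewrite eqd.
- by apply/unsatP; rewrite eqd.
- apply/andP; split; first by apply/ballP => c ltc; apply/implyP => Ec; rewrite memcE eqd cov.
  apply/ballP => j ltj; rewrite !elem_enc !nth_mkseq //; try lia.
  apply/andP; split; case: (boolP (satc _ _ _ _)) => //= /unsatP; rewrite eqd => uw.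
    have := Hq (j + j); rewrite /Q /wi addnn odd_double doubleK; exact.
  by have := Hq (j + j).+1; rewrite /Q /wi addnn /= odd_double uphalf_double; exact.
Qed.

Lemma pi02_exhausted : pi02 [set e | exhausted l r (E e)]%classic.
Proof.
exists checker; split; first exact: computable_checker.
by move=> e; split=> H N; have := H N; [move/checkerP | move=> ?; apply/checkerP].
Qed.
End Checker.

(** * A universal Pi02 relation *)

(** Unlike [enc], this coding is injective: the successor separates the empty list from the others,
    so a judgement determines its argument list. *)
Definition lenc (s : seq nat) := foldr (fun x c => (cpair x c).+1) 0 s.
Definition hd c := cfst c.-1.
Definition tl c := csnd c.-1.

Lemma iter_tl s i : iter i tl (lenc s) = lenc (drop i s).
Proof.
elim: i s => [|i IH] [|x s] //; rewrite iterSr ?[tl _]csnd0 ?[tl _]csndK ?IH //.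
by rewrite (IH [::]).
Qed.

Lemma lenc_eq0 s : (lenc s == 0) = (s == [::]).
Proof. by case: s. Qed.

Lemma iter_tl_eq0 s i : (iter i tl (lenc s) == 0) = (size s <= i).
Proof. by rewrite iter_tl lenc_eq0 -size_eq0 size_drop subn_eq0. Qed.

Lemma hd_iter_tl s i : hd (iter i tl (lenc s)) = nth 0 s i.
Proof.
rewrite iter_tl; case: (ltnP i (size s)) => lti; last by rewrite drop_oversize // nth_default // [hd _](cfstK 0 0).
by rewrite (drop_nth 0) // [hd _]cfstK.
Qed.

Lemma size_lenc s : size s <= lenc s.
Proof. by elim: s => //= x s IH; apply: leq_trans (leq_cpairr _ _). Qed.

(** As [cpair] is not surjective, not every number codes a list. Tails decrease, so testing the
    first [c] of them suffices; [just] needs this for the intermediate values of a composition,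
    which it reads off an earlier judgement. *)
Lemma lenc_of_iter c :
  (forall j, j < c -> iter j tl c != 0 -> iter j tl c = (cpair (hd (iter j tl c)) (iter j.+1 tl c)).+1) ->
  exists s, c = lenc s.
Proof.
have [n] := ubnP c; elim: n c => // n IH [|c] ltc H; first by exists [::].
have ec : c = cpair (hd c.+1) (tl c.+1) by have := H 0 isT isT => /= -[].
have letl : tl c.+1 <= c by rewrite [X in _ <= X]ec leq_cpairr.
have [||s es] := IH (tl c.+1).
- exact: leq_ltn_trans letl ltc.
- move=> j ltj; have := H j.+1; rewrite -!iterSr; apply; exact: leq_trans ltj letl.
by exists (hd c.+1 :: s); rewrite /= -es -ec.
Qed.

Fixpoint code p := match p with
| RZero => cpair 0 0
| RSucc => cpair 1 0
| RProj i => cpair 2 i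
| RComp f gs => cpair 3 (cpair (code f) (lenc [seq code g | g <- gs]))
| RRec f g => cpair 4 (cpair (code f) (code g))
| RMin f => cpair 5 (code f)
end.

Definition entry P A Y := cpair P (cpair A Y).
Definition prev D k t := bex k (fun i => elem D i == t).

(* [just D k t]: the judgement [t], coding "program [cfst t] on arguments [cfst (csnd t)] has value
   [csnd (csnd t)]", follows by one rule of [eval] from the first [k] judgements listed in [D]. *)
Definition just D k t :=
  let P := cfst t in let A := cfst (csnd t) in let Y := csnd (csnd t) in
  let tag := cfst P in let arg := csnd P in
  [|| (tag == 0) && (Y == 0),
      [&& tag == 1, 0 < Y & A == (cpair Y.-1 0).+1],
      [&& tag == 2, iter arg tl A != 0 & Y == hd (iter arg tl A)],
      (tag == 3) && bex k (fun i =>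
        let ys := cfst (csnd (elem D i)) in
        (elem D i == entry (cfst arg) ys Y) &&
        ball (csnd arg + ys).+1 (fun j =>
          [&& (iter j tl (csnd arg) == 0) == (iter j tl ys == 0),
              (iter j tl ys != 0) ==>
                (iter j tl ys == (cpair (hd (iter j tl ys)) (iter j.+1 tl ys)).+1)
            & (iter j tl (csnd arg) != 0) ==>
              prev D k (entry (hd (iter j tl (csnd arg))) A (hd (iter j tl ys)))])),
      [&& tag == 4, A != 0, hd A == 0 & prev D k (entry (cfst arg) (tl A) Y)],
      [&& tag == 4, A != 0, hd A != 0 & bex k (fun i =>
         let z := csnd (csnd (elem D i)) in
         (elem D i == entry P (cpair (hd A).-1 (tl A)).+1 z) &&
         prev D k (entry (csnd arg) (cpair (hd A).-1 (cpair z (tl A)).+1).+1 Y))]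
    | [&& tag == 5, ball Y (fun n => bex k (fun i =>
         let z := csnd (csnd (elem D i)) in (0 < z) && (elem D i == entry arg (cpair n A).+1 z)))
       & prev D k (entry arg (cpair Y A).+1 0)]].

(** [e] pairs a program with a parameter [n]. [z] packs a witness [y] with a derivation that the
    program gives 1 on [n], [x], [y]; the search for [y] and the wait for halting thus become one
    existential quantifier. *)
Definition universal e x z :=
  let y := elem z 0 in let L := elem z 1 in let D := elem z 2 in
  ball L (fun k => just D k (elem D k)) && prev D L (entry (cfst e) (lenc [:: csnd e; x; y]) 1).

Lemma computable_just : computable3 (fun D k t => nat_of_bool (just D k t)).
Proof. by apply: computable3P; rewrite /just /prev /entry /hd /tl; computes_tac. Qed.

Lemma computable_universal : computable3 (fun e x z => nat_of_bool (universal e x z)).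
Proof.
have cj := computable_just.
by apply: computable3P; rewrite /universal /prev /entry /lenc /=; computes_tac.
Qed.

Lemma prevP D k t : reflect (exists2 i, i < k & elem D i = t) (prev D k t).
Proof. by apply: (iffP (bexP _ _)) => -[i lti /eqP]; exists i => //; exact/eqP. Qed.

(** Strong induction on the position of a judgement, since its premises occur earlier in the list.
    Only judgements about genuine codes of programs and lists are claimed to be true. *)
Lemma just_sound D L : (forall k, k < L -> just D k (elem D k)) ->
  forall k p s y, k < L -> elem D k = entry (code p) (lenc s) y -> eval p s y.
Proof.
move=> valid k; have [n] := ubnP k; elim: n k => // n IH k ltk p s y ltL eD.
have IHp p' s' y' : prev D k (entry (code p') (lenc s') y') -> eval p' s' y'.
  move=> /prevP[i lti]; apply: IH; [exact: leq_trans lti ltk | exact: ltn_trans lti ltL].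
have := valid k ltL; rewrite eD /just /entry !csndK !cfstK.
case: p eD => [||i|f gs|f g|f] eD; rewrite !cfstK !csndK ?cfstK ?csndK /= ?orbF.
- by move=> /eqP ->; exact: EvalZero.
- move=> /andP[y0 /eqP e].
  have -> : s = [:: y.-1].
    case: s e {eD} => [|x [|x' s]] //= [] /cpair_inj[-> //].
  by rewrite -{2}(prednK y0); exact: EvalSucc.
- rewrite iter_tl_eq0 hd_iter_tl -ltnNge => /andP[lti /eqP ->].
  exact: EvalProj.
- move=> /bexP[i lti]; set ysc := cfst _ => /andP[/eqP ei /ballP H].
  have [ys eys] : exists ys, ysc = lenc ys.
    apply: lenc_of_iter => j ltj nz.
    have /H/and3P[_ /implyP/(_ nz)/eqP e _] : j < (lenc [seq code g | g <- gs] + ysc).+1 by lia.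
    exact: e.
  rewrite {ysc}eys in ei H *.
  (* A list is no longer than its code, so the bounded quantifier of [just] reaches both lengths,
     where the tails of the two lists vanish simultaneously. *)
  have sz : size ys = size gs.
    have := H (size gs); have := H (size ys); rewrite !iter_tl_eq0 !size_map !leqnn.
    have := size_lenc ys; have := size_lenc [seq code g | g <- gs]; rewrite size_map => l1 l2.
    move=> /(_ _)/andP; case; first by lia.
    move=> /eqP e1 _ /(_ _)/andP; case; first by lia.
    by move=> /eqP e2 _; apply/eqP; rewrite eqn_leq -e2 e1.
  apply: (@EvalComp _ _ _ ys) => // [j ltj|].
    apply: IHp; have /H/and3P[_ _] : j < (lenc [seq code g | g <- gs] + lenc ys).+1.
      by have := size_lenc ys; rewrite sz; lia.
    rewrite iter_tl_eq0 !hd_iter_tl size_map -ltnNge ltj /=.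
    by rewrite (nth_map RZero).
  by apply: IHp; apply/prevP; exists i.
- case: s eD => [|m s] eD; rewrite ?andbF //= ![hd _]cfstK ![tl _]csndK.
  case: m eD => [|m] eD /=; rewrite ?orbF.
    by move/IHp; exact: EvalRec0.
  move=> /bexP[i lti /andP[/eqP ei Hp]]; set z := csnd _ in ei Hp.
  apply: (@EvalRecS _ _ _ _ z); last exact: IHp.
  by apply: IHp; apply/prevP; exists i.
- move=> /andP[/ballP H Hp].
  (* [EvalMin] asks for one function listing the predecessors of all earlier values. It is obtained
     by choice; the default 0 is never taken below the minimizer. *)
  pose t m := (xget 0 [set z | eval f (m :: s) z.+1]%classic).
  apply: (@EvalMin _ _ _ t) => [m ltm|]; last exact: IHp.
  have [i lti /andP[z0 /eqP ei]] := bexP _ _ (H m ltm); set z := csnd _ in z0 ei.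
  have ez : eval f (m :: s) z by apply: IHp; apply/prevP; exists i.
  by apply: (@xgetPex _ 0 [set z | eval f (m :: s) z.+1]%classic); exists z.-1; rewrite /= prednK.
Qed.

Lemma eval_det p s y : eval p s y -> forall y', eval p s y' -> y = y'.
Proof.
elim=> {p s y}.
- by move=> s y' H; inversion H.
- by move=> x y' H; inversion H.
- by move=> i s _ y' H; inversion H.
- move=> f gs s ys y sz _ IH _ IHf y' H; inversion H; subst.
  have eys : ys = ys0.
    apply: (@eq_from_nth _ 0) => [|i]; first by rewrite sz; symmetry.
    by rewrite sz => lti; apply: IH => //; auto.
  by apply: IHf; rewrite eys.
- by move=> f g s y _ IH y' H; inversion H; auto.
- move=> f g n s z y _ IH1 _ IH2 y' H; inversion H; subst.
  by match goal with Hz : eval (RRec f g) _ _ |- _ => apply: IH2; rewrite (IH1 _ Hz) end.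
- move=> f s n t _ IH1 _ IH2 y' H; inversion H; subst.
  case: (ltngtP n y') => // lt.
    by match goal with Hm : _ |- _ => have := IH2 _ (Hm _ lt) end.
  by match goal with Hm : eval f (y' :: s) 0 |- _ => have := IH1 _ lt _ Hm end.
Qed.

(** * Completeness of derivation lists *)

Definition valid es := forall k, k < size es -> just (enc es) k (nth 0 es k).

Lemma prev_enc es k t : k <= size es -> prev (enc es) k t = (t \in take k es).
Proof.
move=> lek; apply/prevP/(nthP 0) => -[i lti]; rewrite ?elem_enc ?size_takel //.
  by exists i; rewrite ?size_takel // nth_take.
by rewrite size_takel // in lti; rewrite nth_take // => <-; exists i; rewrite ?elem_enc.
Qed.

Lemma bex_mono (Q : nat -> bool) D D' k k' :
  (forall t, prev D k t -> prev D' k' t) ->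
  bex k (fun i => Q (elem D i)) -> bex k' (fun i => Q (elem D' i)).
Proof.
move=> sub /bexP[i lti Qi]; have /sub/prevP[j ltj ej] : prev D k (elem D i) by apply/prevP; exists i.
by apply/bexP; exists j; rewrite ?ej.
Qed.

(** The rules consult the list only through the presence of judgements. Hence derivation lists may
    be concatenated, which is how the premises of a rule are brought together. *)
Lemma just_mono D D' k k' t :
  (forall t, prev D k t -> prev D' k' t) -> just D k t -> just D' k' t.
Proof.
move=> sub; rewrite /just; set P := cfst t; set A := cfst (csnd t); set Y := csnd (csnd t).
do 3 (case/orP=> [->|]; [by rewrite ?orbT|]).
case/orP=> [/andP[-> H]|]; [apply/or4P; constructor 4; apply/orP; left; rewrite /=|].
  move: H => /bexP[i lti /andP[e /ballP H]].
  have /sub/prevP[j ltj ej] : prev D k (elem D i) by apply/prevP; exists i.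
  apply/bexP; exists j => //; rewrite ej e /=; apply/ballP => h lth.
  have /and3P[-> -> /implyP H3] := H h lth; rewrite /=.
  by apply/implyP => /H3/sub.
case/orP=> [/and4P[-> -> -> /sub ->]|]; first by rewrite ?orbT.
case/orP=> [/and4P[-> -> -> /bexP[i lti /andP[e /sub Hp]]]|/and3P[-> /ballP H /sub ->]].
  have /sub/prevP[j ltj ej] : prev D k (elem D i) by apply/prevP; exists i.
  do 5 (apply/orP; right); apply/orP; left; rewrite /=.
  by apply/bexP; exists j; rewrite // ej e.
do 6 (apply/orP; right); rewrite andbT /=.
apply/ballP => n /H; exact: (@bex_mono (fun d => (0 < csnd (csnd d)) && (d == entry _ _ (csnd (csnd d))))).
Qed.

Lemma valid_cat es es' : valid es -> valid es' -> valid (es ++ es').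
Proof.
move=> v v' k; rewrite size_cat nth_cat => ltk.
have lek : k <= size (es ++ es') by rewrite size_cat ltnW.
case: ltnP => lt.
  apply: just_mono (v k lt) => t; rewrite !prev_enc ?(ltnW lt) //.
  by rewrite takel_cat // ltnW.
have lt' : k - size es < size es' by move: ltk lt; move: (size es) (size es') => *; lia.
apply: just_mono (v' _ lt') => t; rewrite !prev_enc ?(ltnW lt') //.
by rewrite take_cat ltnNge lt /= mem_cat => ->; rewrite orbT.
Qed.

Lemma valid_rcons es t : valid es -> just (enc es) (size es) t -> valid (rcons es t).
Proof.
move=> v j k; rewrite size_rcons ltnS leq_eqVlt nth_rcons => /orP[/eqP->|lt].
  rewrite ltnn eqxx; apply: just_mono j => t'; rewrite !prev_enc ?size_rcons //.
  by rewrite -cats1 take_size_cat // take_size.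
rewrite lt; apply: just_mono (v k lt) => t'; rewrite !prev_enc ?size_rcons; try exact: ltnW.
  by rewrite -cats1 takel_cat // ltnW.
by rewrite ltnW // ltnW.
Qed.

Lemma valid_collect n (T : nat -> nat) :
  (forall i, i < n -> exists es, valid es /\ T i \in es) ->
  exists es, valid es /\ forall i, i < n -> T i \in es.
Proof.
elim: n => [|n IH] H; first by exists [::].
have [|es [v Hes]] := IH; first by move=> i lti; apply: H; exact: leqW.
have [es' [v' Hn]] := H n (leqnn _); exists (es ++ es'); split; first exact: valid_cat.
move=> i; rewrite ltnS leq_eqVlt mem_cat => /orP[/eqP->|/Hes ->//]; by rewrite Hn orbT.
Qed.

Lemma eval_valid p s y : eval p s y ->
  exists es, valid es /\ entry (code p) (lenc s) y \in es.
Proof.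
have conclude es t : valid es -> just (enc es) (size es) t -> exists es, valid es /\ t \in es.
  by move=> v j; exists (rcons es t); rewrite mem_rcons mem_head; split=> //; exact: valid_rcons.
have inP es t : t \in es -> prev (enc es) (size es) t by move=> H; rewrite prev_enc // take_size.
have exP es t : t \in es -> exists2 i, i < size es & elem (enc es) i = t.
  by move/inP/prevP.
elim=> {p s y}.
- by move=> s; apply: (conclude [::]) => //; rewrite /just /entry !csndK !cfstK.
- by move=> x; apply: (conclude [::]) => //; rewrite /just /entry !csndK !cfstK /= eqxx.
- move=> i s lti; apply: (conclude [::]) => //; rewrite /just /entry !csndK !cfstK /=.
  by rewrite ?(cfstK, csndK) iter_tl_eq0 hd_iter_tl -ltnNge lti eqxx.
- move=> f gs s ys y sz _ IH _ [es1 [v1 H1]].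
  have [es2 [v2 H2]] := valid_collect IH.
  apply: (conclude (es1 ++ es2)); first exact: valid_cat.
  rewrite /just /entry !csndK !cfstK /= !(cfstK, csndK) /= !orbF.
  have [|i lti ei] := exP (es1 ++ es2) (entry (code f) (lenc ys) y); first by rewrite mem_cat H1.
  apply/bexP; exists i => //; rewrite ei /entry !(cfstK, csndK) eqxx /=; apply/ballP => j _.
  rewrite !iter_tl_eq0 !hd_iter_tl size_map sz eqxx /=; apply/andP; split.
    apply/implyP; rewrite -ltnNge => ltj; rewrite iter_tl (drop_nth 0) ?sz //.
    by rewrite /= [tl _]csndK.
  apply/implyP; rewrite -ltnNge => ltj; apply: inP; rewrite mem_cat (nth_map RZero) //.
  by rewrite H2 ?orbT.
- move=> f g s y _ [es [v H]]; apply: (conclude es) => //.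
  rewrite /just /entry !csndK !cfstK /= !(cfstK, csndK) /=.
  by rewrite [hd _]cfstK [tl _]csndK /= inP.
- move=> f g n s z y _ [es1 [v1 H1]] _ [es2 [v2 H2]].
  apply: (conclude (es1 ++ es2)); first exact: valid_cat.
  rewrite /just /entry !csndK !cfstK /= !(cfstK, csndK) /= !orbF.
  rewrite [hd _]cfstK [tl _]csndK /=.
  have [|i lti ei] := exP (es1 ++ es2) _ (_ : entry (code (RRec f g)) (lenc (n :: s)) z \in _).
    by rewrite mem_cat H1.
  apply/bexP; exists i => //; rewrite ei /entry !(cfstK, csndK) eqxx /=.
  by apply: inP; rewrite mem_cat H2 orbT.
- move=> f s n t _ IH _ [es1 [v1 H1]].
  have [es2 [v2 H2]] := valid_collect IH.
  apply: (conclude (es1 ++ es2)); first exact: valid_cat.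
  rewrite /just /entry !csndK !cfstK /= !(cfstK, csndK) /=; apply/andP; split; last first.
    by apply: inP; rewrite mem_cat H1.
  apply/ballP => i lti.
  have [|j ltj ej] := exP (es1 ++ es2) _ (_ : entry (code f) (lenc (i :: s)) (t i).+1 \in _).
    by rewrite mem_cat H2 ?orbT.
  by apply/bexP; exists j => //; rewrite ej /entry !(cfstK, csndK) eqxx.
Qed.

Lemma universalP p n x (R : nat -> bool) :
  (forall y, eval p [:: n; x; y] (R y)) ->
  (exists z, universal (cpair (code p) n) x z) <-> exists y, R y.
Proof.
move=> Hp; split=> [[z]|[y Ry]].
  rewrite /universal cfstK csndK; set y := elem z 0; set L := elem z 1; set D := elem z 2.
  move=> /andP[/ballP v /prevP[i lti ei]].
  (* By determinism the derived value 1 is the value of [R y]. *)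
  have := just_sound v lti ei => /eval_det/(_ _ (Hp y)) e.
  by exists y; move: e; case: (R y).
have := Hp y; rewrite Ry => /eval_valid[es [v H]].
exists (enc [:: y; size es; enc es]); rewrite /universal !elem_enc cfstK csndK /=.
apply/andP; split; last by rewrite prev_enc // take_size.
by apply/ballP => k /v; rewrite elem_enc.
Qed.

Local Open Scope classical_set_scope.
Local Open Scope card_scope.

(** * Coding the edges of a multigraph by natural numbers *)

Definition left_end := cfst.
Definition right_end c := cfst (csnd c).

(** The [i]-th edge joining [u] and [v]. Ordering the ends gives each edge a single code, and the
    first test rejects numbers that are not triples. *)
Definition edge_code (V : nat -> bool) (m : nat -> nat -> nat) c :=
  let u := cfst c in let v := cfst (csnd c) in let i := csnd (csnd c) in
  [&& c == cpair u (cpair v i), u <= v, V u, V v & i < m u v].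

Lemma card_image_seq (T : Type) (A : set T) n (f : T -> nat) :
  (A #= `I_n)%card -> injective f ->
  exists s : seq nat, [/\ uniq s, size s = n & forall c, c \in s <-> exists x, A x /\ f x = c].
Proof.
move=> /card_set_bijP[g [gf ginj gsurj]] finj.
have [h Hh] : {h : 'I_n -> T & forall i, A (h i) /\ g (h i) = i}.
  apply: (@choice _ _ (fun (i : 'I_n) x => A x /\ g x = i)) => i.
  by have [x Ax <-] := gsurj i (ltn_ord i); exists x.
exists [seq f (h i) | i <- enum 'I_n]; split.
- rewrite map_inj_uniq ?enum_uniq // => i j /finj e.
  by apply: val_inj; rewrite /= -(Hh i).2 -(Hh j).2 e.
- by rewrite size_map size_enum_ord.
- move=> c; split=> [/mapP[i _ ->]|[x [Ax <-]]]; first by exists (h i); split=> //; case: (Hh i).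
  have ltx : g x < n by exact: gf.
  apply/mapP; exists (Ordinal ltx); rewrite ?mem_enum //; congr f.
  by apply: ginj; rewrite ?inE //; [exact: (Hh _).1 | rewrite (Hh _).2].
Qed.

Lemma two_way_coding (G : multigraph) (l r : nat -> nat) (E : pred nat) (code : edge G -> nat) :
  injective code -> (forall x, E (code x)) -> (forall c, E c -> exists x, code x = c) ->
  (forall x, joins x (l (code x)) (r (code x))) ->
  has_two_way_eulerian_path G <-> exists v x : int -> nat, two_way_trail l r E v x.
Proof.
move=> cinj cE csurj cj.
have joinsE x u v : joins x u v <-> incident l r (code x) u /\ other_end l r (code x) u = v.
  have := cj x; rewrite /joins /incident /other_end.
  move: (l _) (r _) => a b; case: (ends x) => a' b'.
  case=> -[-> ->]; split.
  - by case=> -[-> ->]; rewrite ?eqxx ?orbT; split=> //; case: eqP.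
  - by case: eqP => [->|_] /= [+ <-]; auto; move=> /eqP ->; auto.
  - by case=> -[-> ->]; rewrite ?eqxx ?orbT; split=> //; case: eqP.
  - by case: eqP => [->|_] /= [+ <-]; auto; move=> /eqP ->; auto.
split=> [[v [x [Hj Hu]]]|[v [x [HE Hst Hsur xinj]]]].
  exists v, (code \o x); split=> /=.
  - by move=> n; exact: cE.
  - by move=> n; exact/joinsE.
  - by move=> c /csurj[y <-]; have [n [<- _]] := Hu y; exists n.
  - move=> n k /= /cinj e; have [n' [_ un]] := Hu (x k).
    by rewrite -(un n e) -(un k erefl).
have [y Hy] : {y : int -> edge G & forall n, code (y n) = x n}.
  by apply: (@choice _ _ (fun n y => code y = x n)) => n; exact: csurj.
exists v, y; split=> [n|z].
  by apply/joinsE; rewrite Hy; exact: Hst.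
have [n en] := Hsur (code z) (cE z); exists n; split.
  by apply: cinj; rewrite Hy.
by move=> k ek; apply: xinj; rewrite en -ek Hy.
Qed.

Section Recode.
Variables (G : multigraph) (V : nat -> bool) (m : nat -> nat -> nat).
Hypothesis vV : forall v, vert G v <-> V v.
Hypothesis em : forall u v, vert G u -> vert G v -> (edges_between G u v #= `I_(m u v))%card.

Notation E := (edge_code V m).
Notation inc := (incident left_end right_end).
Notation oth := (other_end left_end right_end).

Lemma edge_codeP c : reflect
  (exists u v i, [/\ c = cpair u (cpair v i), u <= v, V u, V v & i < m u v]) (E c).
Proof.
apply: (iffP idP) => [/and5P[/eqP e ? ? ? ?]|[u [v [i [-> ? ? ? ?]]]]].
  by exists (cfst c), (cfst (csnd c)), (csnd (csnd c)).
by rewrite /edge_code !cfstK !csndK !cfstK eqxx /=; apply/and4P; split; rewrite ?csndK.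
Qed.

(** The bijections between parallel edges and their indices come from choice and need not be
    effective: only the set of codes and the ends of a code have to be computable. *)
Lemma edge_coding : exists code : edge G -> nat, [/\ injective code,
  forall x, E (code x), forall c, E c -> exists x, code x = c
  & forall x, joins x (left_end (code x)) (right_end (code x))].
Proof.
have [phi Hphi] : {phi : nat * nat -> edge G -> nat & forall uv, V uv.1 -> V uv.2 ->
    set_bij (edges_between G uv.1 uv.2) `I_(m uv.1 uv.2) (phi uv)}.
  apply: (@choice _ _ (fun uv f => V uv.1 -> V uv.2 ->
    set_bij (edges_between G uv.1 uv.2) `I_(m uv.1 uv.2) f)) => -[u v] /=.
  case: (pselect (V u /\ V v)) => [[/vV Vu /vV Vv]|nV].
    by have /card_set_bijP[f Hf] := em Vu Vv; exists f.
  by exists (fun=> 0) => Vu Vv; case: nV.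
pose lo x := minn (@ends G x).1 (ends x).2.
pose hi x := maxn (@ends G x).1 (ends x).2.
pose code x := cpair (lo x) (cpair (hi x) (phi (lo x, hi x) x)).
have jx x : joins x (lo x) (hi x).
  rewrite /joins /lo /hi; case: (ends x) => a b /=.
  by case: (leqP a b) => _; auto.
have Vx x : V (lo x) /\ V (hi x).
  have [/vV V1 /vV V2] := ends_vert x; rewrite /lo /hi.
  by case: (leqP (ends x).1 (ends x).2).
have lex x : lo x <= hi x by rewrite /lo /hi geq_min leq_max leqnn.
exists code; split.
- move=> x y /cpair_inj[e1 /cpair_inj[e2]]; rewrite e1 e2.
  have [V1 V2] := Vx y; have [_ inj _] := Hphi (lo y, hi y) V1 V2.
  by apply: inj; rewrite inE /edges_between /=; [rewrite -e1 -e2 |]; exact: jx.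
- move=> x; apply/edge_codeP; exists (lo x), (hi x), (phi (lo x, hi x) x).
  have [V1 V2] := Vx x; split=> //.
  by have [sf _ _] := Hphi (lo x, hi x) V1 V2; apply: sf; exact: jx.
- move=> c /edge_codeP[u [v [i [-> leuv Vu Vv lti]]]].
  have [_ _ surj] := Hphi (u, v) Vu Vv.
  have [x jxuv ei] := surj i lti; exists x.
  have [e1 e2] : lo x = u /\ hi x = v.
    by rewrite /lo /hi; case: jxuv => -> /=; lia.
  by rewrite /code e1 e2 ei.
- by move=> x; rewrite /left_end /right_end /code cfstK csndK cfstK; exact: jx.
Qed.

Lemma two_way_recode : has_two_way_eulerian_path G <->
  exists v x : int -> nat, two_way_trail left_end right_end E v x.
Proof. by have [code [h1 h2 h3 h4]] := edge_coding; exact: (two_way_coding h1 h2 h3 h4). Qed.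

(** * Edge bounds from the degree function *)

Definition degree_upto v K :=
  bsum K (fun c => E c * ((left_end c == v) + (right_end c == v))).

Lemma degree_upto_lim v d : has_degree G v d ->
  exists K0, forall K, K0 <= K -> degree_upto v K = d.
Proof.
move=> [a [b [ca cb ->]]].
have [code [cinj cE csurj cj]] := edge_coding.
have [s1 [u1 z1 m1]] := card_image_seq ca cinj.
have [s2 [u2 z2 m2]] := card_image_seq cb cinj.
have [c i n lei lti|c _|K0 HK] := @bounded_choice _ (s1 ++ s2) (fun c K => c < K).
- exact: leq_trans lti lei.
- by exists c.+1.
exists K0 => K leK.
have lt1 c : c \in s1 -> c < K.
  by move=> cs; apply: leq_trans leK; apply: HK; rewrite mem_cat cs.
have lt2 c : c \in s2 -> c < K.
  by move=> cs; apply: leq_trans leK; apply: HK; rewrite mem_cat cs orbT.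
have memE c : E c * ((left_end c == v) + (right_end c == v)) = (c \in s1) + 2 * (c \in s2).
  have e1 : (c \in s1) = [&& E c, left_end c != right_end c & (left_end c == v) || (right_end c == v)].
    apply/idP/idP => [/m1[x [[u nuv jx] <-]]|/and3P[/csurj[x <-] ne iv]].
      rewrite cE /=; have := cj x; move: jx; rewrite /joins.
      move: (left_end _) (right_end _) => a' b'; case: (ends x) => a'' b''.
      move=> jx jx'; apply/andP; split; last by case: jx jx' => -[-> ->] [] [<- <-]; rewrite eqxx ?orbT.
      by apply/eqP; case: jx jx' => -[-> ->] [] [<- <-]; auto.
    apply/m1; exists x; split=> //; rewrite /links_at /=.
    have := cj x; move: ne iv; move: (left_end _) (right_end _) => a' b' ne iv jx.
    case/orP: iv => /eqP <-; [exists b' | exists a'] => //; try exact/eqP.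
      by apply/eqP; rewrite eq_sym.
    by case: jx; rewrite /joins; auto.
  have e2 : (c \in s2) = [&& E c, left_end c == v & right_end c == v].
    apply/idP/idP => [/m2[x [jx <-]]|/and3P[/csurj[x <-] /eqP e1' /eqP e2']].
      rewrite cE /=; have := cj x; move: jx; rewrite /loops_at /joins /=.
      move: (left_end _) (right_end _) => a' b'; case: (ends x) => a'' b''.
      by case=> -[-> ->] [] [<- <-]; rewrite eqxx.
    apply/m2; exists x; split=> //; have := cj x; rewrite e1' e2'; exact.
  rewrite e1 e2; case: (E c) => //=; case: (eqVneq (left_end c) (right_end c)) => [->|ne] /=.
    by case: eqP.
  case: (eqVneq (left_end c) v) => [e|_] /=; last by case: eqP.
  by rewrite -e eq_sym (negbTE ne).
rewrite /degree_upto /bsum (eq_bigr (fun i : 'I_K => (val i \in s1) + 2 * (val i \in s2))) => [|i _]; last exact: memE.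
rewrite big_split /= -big_distrr /=.
have cnt (s : seq nat) : uniq s -> (forall c, c \in s -> c < K) -> \sum_(i < K) (val i \in s) = size s.
  move=> us sK; rewrite -(big_mkord xpredT (fun c => nat_of_bool (c \in s))).
  rewrite -big_mkcond /= sum1_count -size_filter; apply/perm_size/uniq_perm => //.
    by rewrite filter_uniq // iota_uniq.
  move=> c; rewrite mem_filter mem_index_iota /=.
  by case: (boolP (c \in s)) => // /sK ->.
by rewrite !cnt // z1 z2.
Qed.

(** Once the edges with codes below [K] account for the full degree, a further edge at [v] would
    push the count beyond it. Searching for such a [K] yields a computable edge bound. *)
Lemma degree_upto_bound v d K c : has_degree G v d -> degree_upto v K = d -> E c -> inc c v -> c < K.
Proof.
move=> /degree_upto_lim[K0 HK0] eK Ec icv; rewrite ltnNge; apply/negP => leKc.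
pose K1 := maxn K0 c.+1.
have : degree_upto v K1 = d by apply: HK0; rewrite leq_maxl.
have le1 : K <= K1 by apply: leq_trans (leqW leKc) (leq_maxr _ _).
rewrite -{}eK /degree_upto /bsum -!(big_mkord xpredT (fun c => E c * ((left_end c == v) + (right_end c == v)))).
rewrite (big_cat_nat_idem _ _ le1) //= -[RHS]addn0 => /eqP; rewrite eqn_add2l (big_rem c) /=; last first.
  by rewrite mem_index_iota leKc leq_maxr.
by rewrite Ec mul1n; move: icv; rewrite /incident; case: eqP => //= _; case: eqP.
Qed.
End Recode.

Lemma pi02_two_way G : uniformly_highly_computable G ->
  pi02 [set e | has_two_way_eulerian_path (G e)]%classic.
Proof.
move=> [[V [cV vV]] [m [cm em]] _ [d [cd dd]]].
pose E e := edge_code (V e) (m e).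
have cE : computable2 (fun e c => nat_of_bool (E e c)).
  by apply: computable2P; rewrite /E /edge_code; computes_tac.
(* The second disjunct lets the search for [K] terminate at numbers that are not vertices. *)
pose P (q : nat * nat) K := (degree_upto (V q.1) (m q.1) q.2 K == d q.1 q.2) || ~~ V q.1 q.2.
have exP q : exists K, P q K.
  rewrite /P; case: (boolP (V q.1 q.2)) => [Vq|_]; last by exists 0; rewrite orbT.
  have [|K0 HK] := degree_upto_lim (vV q.1) (em q.1) (dd q.1 q.2 _); first exact/vV.
  by exists K0; rewrite HK // eqxx.
pose B e v := ex_minn (exP (e, v)).
have cB : computable2 B.
  apply: computable2P; apply: (@computes_mu _ _ P) => [|q|q i lti].
  - by rewrite /P /degree_upto /edge_code /left_end /right_end; computes_tac.
  - by rewrite /B; case: ex_minnP; case: q.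
  - move: lti; rewrite /B; case: ex_minnP => n _ minn ltin; apply/negP => /minn.
    by rewrite leqNgt ltin.
have EB e : edge_bound left_end right_end (E e) (B e).
  move=> w c Ec icw; rewrite /B; case: ex_minnP => n + _.
  have Vw : V e w.
    have /edge_codeP[u [v [i [ec _ Vu Vv _]]]] := Ec; move: icw.
    by rewrite /incident /left_end /right_end ec cfstK csndK cfstK => /orP[] /eqP <-.
  rewrite /P /= Vw orbF => /eqP en.
  exact: (degree_upto_bound (vV e) (em e) (dd e w ((vV e w).2 Vw)) en).
have cl : computable1 left_end by exact: computable_cfst.
have cr : computable1 right_end by apply: computable1P; rewrite /right_end; computes_tac.
have [R [cR HR]] := pi02_exhausted cE cB cl cr EB.
exists R; split=> // e; rewrite -HR; split=> /=.
  move/(two_way_recode (vV e) (em e)) => [v [x tr]]; exact: exhausted_of_two_way tr.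
move=> ex; apply/(two_way_recode (vV e) (em e)).
exact: two_way_of_exhausted (EB e) ex.
Qed.

(** * Multigraphs with coded edges *)

Section CodedGraph.
Variables (V E : nat -> nat -> bool) (l r : nat -> nat) (B : nat -> nat -> nat).
Hypothesis EV : forall e c, E e c -> V e (l c) /\ V e (r c).
Hypothesis EB : forall e, edge_bound l r (E e) (B e).

Definition coded_graph e : multigraph :=
  @Multigraph [set v | V e v] {c | E e c} (fun x => (l (val x), r (val x)))
    (fun x => EV (valP x)).

Lemma card_coded e (P : pred nat) K : (forall c, E e c -> P c -> c < K) ->
  [set x : edge (coded_graph e) | P (val x)] #= `I_(bsum K (fun c => nat_of_bool (E e c && P c))).
Proof.
move=> HK; pose s := [seq c <- iota 0 K | E e c && P c].
have -> : bsum K (fun c => nat_of_bool (E e c && P c)) = size s.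
  rewrite /bsum -(big_mkord xpredT (fun c => nat_of_bool (E e c && P c))).
  by rewrite -big_mkcond /= sum1_count -size_filter /index_iota subn0.
have us : uniq s by rewrite filter_uniq // iota_uniq.
have mems (x : {c | E e c}) : P (val x) -> val x \in s.
  move=> Px; rewrite mem_filter Px (valP x) mem_iota /= add0n; apply: HK => //; exact: (valP x).
apply/card_set_bijP; exists (fun x : {c | E e c} => index (val x) s); split.
- by move=> x Px /=; rewrite index_mem mems.
- move=> x y; rewrite !inE /= => Px Py exy; apply: val_inj.
  by rewrite -(nth_index 0 (mems x Px)) exy nth_index // mems.
- move=> i /= lti; have := mem_nth 0 lti; rewrite mem_filter => /andP[/andP[Ei Pi] _].
  by exists (exist (fun c => is_true (E e c)) _ Ei) => //=; rewrite index_uniq.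
Qed.

Lemma coded_uhc : computable2 (fun e v => nat_of_bool (V e v)) ->
  computable2 (fun e c => nat_of_bool (E e c)) -> computable1 l -> computable1 r ->
  computable2 B -> uniformly_highly_computable coded_graph.
Proof.
move=> cV cE cl cr cB; split.
- by exists V.
- exists (fun e u v => bsum (B e u) (fun c => nat_of_bool (E e c &&
    (((l c == u) && (r c == v)) || ((l c == v) && (r c == u)))))).
  split; first by apply: computable3P; computes_tac.
  move=> e u v _ _.
  rewrite (_ : edges_between _ u v = [set x : edge (coded_graph e) |
    ((l (val x) == u) && (r (val x) == v)) || ((l (val x) == v) && (r (val x) == u))]).
    apply: card_coded => c Ec H; apply: (EB Ec); rewrite /incident.
    by case/orP: H => /andP[h1 h2]; rewrite ?h1 ?h2 ?orbT.
  apply/seteqP; split=> x; rewrite /edges_between /joins /=.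
    by case=> -[-> ->]; rewrite !eqxx ?orbT.
  by case/orP=> /andP[/eqP-> /eqP->]; auto.
- move=> e v _; apply/finite_setP.
  rewrite (_ : _ `|` _ = [set x : edge (coded_graph e) | incident l r (val x) v]).
    exists (bsum (B e v) (fun c => nat_of_bool (E e c && incident l r c v))).
    by apply: (@card_coded e (incident l r ^~ v)) => c Ec; exact: EB.
  apply/seteqP; split=> x; rewrite /links_at /loops_at /joins /= /incident.
    by case=> [[u _]|] [] [-> ->]; rewrite eqxx ?orbT.
  case: (eqVneq (l (val x)) (r (val x))) => [->|ne]; rewrite ?orbb => H.
    by right; left; rewrite (eqP H).
  left; case/orP: H => /eqP <-; [exists (r (val x)); auto | exists (l (val x)); auto].
    by apply/eqP; rewrite eq_sym.
  exact/eqP.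
- exists (fun e v => bsum (B e v) (fun c => E e c * ((l c == v) + (r c == v)))).
  split; first by apply: computable2P; computes_tac.
  move=> e v _.
  exists (bsum (B e v) (fun c => nat_of_bool (E e c && (incident l r c v && (l c != r c))))).
  exists (bsum (B e v) (fun c => nat_of_bool (E e c && ((l c == v) && (r c == v))))).
  split.
  + rewrite (_ : links_at _ v = [set x : edge (coded_graph e) | incident l r (val x) v && (l (val x) != r (val x))]).
      by apply: card_coded => c Ec /andP[+ _]; exact: EB.
    apply/seteqP; split=> x; rewrite /links_at /joins /= /incident.
      by case=> u nu [] [-> ->]; rewrite eqxx ?orbT /=; apply/eqP; auto.
    case/andP=> H ne; case/orP: H => /eqP <-; [exists (r (val x)); auto | exists (l (val x)); auto].
      by apply/eqP; rewrite eq_sym.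
    exact/eqP.
  + rewrite (_ : loops_at _ v = [set x : edge (coded_graph e) | (l (val x) == v) && (r (val x) == v)]).
      by apply: card_coded => c Ec /andP[H _]; apply: (EB Ec); rewrite /incident H.
    apply/seteqP; split=> x; rewrite /loops_at /joins /=.
      by case=> -[-> ->]; rewrite eqxx.
    by case/andP=> /eqP-> /eqP->; auto.
  + rewrite /bsum big_distrr -big_split /=; apply: eq_bigr => -[c /= _] _.
    case: (E e c) => //=; rewrite mul1n /incident.
    case: (eqVneq (l c) (r c)) => [->|ne] /=; first by case: eqP.
    rewrite andbT; case: (eqVneq (l c) v) => [ev|_] /=; last by case: eqP.
    by rewrite -ev eq_sym (negbTE ne).
Qed.

Lemma coded_two_way e : has_two_way_eulerian_path (coded_graph e) <->
  exists v x : int -> nat, two_way_trail l r (E e) v x.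
Proof.
apply: (@two_way_coding (coded_graph e) l r (E e) (fun x : {c | E e c} => val x)).
- exact: val_inj.
- by move=> x; exact: (valP x).
- by move=> c Ec; exists (exist (fun c => is_true (E e c)) c Ec).
- by move=> x; left.
Qed.

Lemma coded_connected e u0 :
  (forall u, V e u -> exists p, [/\ is_walk l r u p, all (E e) p & walk_end l r u p = u0]) ->
  graph_connected (coded_graph e).
Proof.
move=> H u v Vu Vv; have [p [wp Ep dp]] := H u Vu; have [q [wq Eq dq]] := H v Vv.
have [wrq drq] := walk_rev wq; rewrite dq in wrq drq.
pose s := p ++ rev q.
have ws : is_walk l r u s by rewrite walk_cat wp dp.
have Es : all (E e) s by rewrite all_cat Ep all_rev.
exists (size s), (fun i => walk_end l r u (take i s)); split.
- by rewrite take0.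
- by rewrite take_size dst_cat dp.
- move=> i lti; have /allP/(_ _ (mem_nth 0 lti)) Ei := Es.
  exists (exist (fun c => is_true (E e c)) _ Ei : edge (coded_graph e)); rewrite /joins /=.
  move: ws; rewrite -{1}(cat_take_drop i s) (drop_nth 0) // walk_cat => /and3P[_ inci _].
  rewrite (take_nth 0) // -cats1 dst_cat /=; move: inci; rewrite /incident /other_end.
  by case: eqP => [->|_ /= /eqP->]; auto.
Qed.
End CodedGraph.

(* A two-way trail crosses the two-edge cut twice, so one of the two sides is visited only during
   a finite interval of time. *)
Lemma two_way_two_cut l r (E : pred nat) v x (S : pred nat) f1 f2 :
  two_way_trail l r E v x -> f1 != f2 -> E f1 -> E f2 ->
  (forall f, E f -> (S (l f) != S (r f)) = (f == f1) || (f == f2)) ->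
  ~ (forall (a : bool) N, exists f, [/\ N <= f, E f, S (l f) = a & S (r f) = a]).
Proof.
move=> tr nf Ef1 Ef2 cut both; have [HE Hst Hsur inj] := tr.
have [t1 e1] := Hsur _ Ef1; have [t2 e2] := Hsur _ Ef2.
wlog lt12 : f1 f2 t1 t2 nf Ef1 Ef2 cut e1 e2 / (t1 < t2)%R.
  move=> W; case: (boolP (t1 < t2)%R) => [lt|nl1]; first exact: (W f1 f2 t1 t2).
  case: (boolP (t2 < t1)%R) => [lt|nl2].
    by apply: (W f2 f1 t2 t1) => //; [rewrite eq_sym | move=> f Ef; rewrite orbC cut].
  have e : t1 = t2 by lia.
  by move: nf; rewrite -e1 -e2 e eqxx.
have step n : n <> t1 -> n <> t2 -> S (l (x n)) = S (r (x n)).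
  move=> n1 n2; have := cut (x n) (HE n); rewrite -e1 -e2.
  case: (x n =P x t1) => [/inj //|_]; case: (x n =P x t2) => [/inj //|_].
  rewrite /=.
  by case: (S (l _)); case: (S (r _)).
have jump n : (n = t1) \/ (n = t2) -> S (v n) != S (v (n + 1)%R).
  have [i1 <-] := Hst n; move=> tn.
  have : S (l (x n)) != S (r (x n)).
    by rewrite cut // -e1 -e2; case: tn => ->; rewrite eqxx ?orbT.
  by move: i1; rewrite /incident /other_end; case: eqP => [<-//|_ /= /eqP <-]; rewrite eq_sym.
have const s k : (forall i, i < k -> (s + i%:Z)%R <> t1 /\ (s + i%:Z)%R <> t2) -> S (v s) = S (v (s + k%:Z)%R).
  move=> H; have [w1 <-] := walk_window tr s k; apply: (walk_inv w1) => f /mem_window[i lti ->].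
  by apply: step; case: (H i lti).
(* [al] is the side visited between the two crossings. *)
pose al := S (v (t1 + 1)%R).
have Sin n : (t1 < n)%R -> (n <= t2)%R -> S (v n) = al.
  move=> h1 h2; rewrite (_ : n = (t1 + 1) + (`|(n - (t1 + 1))%R|%N)%:Z)%R; last by lia.
  by symmetry; apply: const => i lti; split; lia.
have Sout n : (n <= t1)%R \/ (t2 < n)%R -> S (v n) = ~~ al.
  case=> h.
    have -> : S (v n) = S (v t1).
      rewrite [X in _ = S (v X)](_ : t1 = n + (`|t1 - n|%N)%:Z)%R; last by lia.
      by apply: const => i lti; split; lia.
    by have := jump t1 (or_introl erefl); rewrite -/al; case: (S (v t1)); case: (al).
  have -> : S (v n) = S (v (t2 + 1)%R).
    rewrite (_ : n = (t2 + 1) + (`|(n - (t2 + 1))%R|%N)%:Z)%R; last by lia.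
    by symmetry; apply: const => i lti; split; lia.
  have := jump t2 (or_intror erefl); rewrite (Sin t2) //.
  by case: (S _); case: (al).
have [c i n lei lti|c _|K HK] := @bounded_choice _ (window x t1 `|t2 - t1|%N) (fun c K => c < K).
- exact: leq_trans lti lei.
- by exists c.+1.
(* An edge inside side [al] whose code exceeds those of all edges traversed from one crossing to the
   other; it can be traversed at no time. *)
have [f [leK Ef Sl Sr]] := both al K.
have [n en] := Hsur f Ef.
have [Sn Sn1] : S (v n) = al /\ S (v (n + 1)%R) = al.
  have [i1 <-] := Hst n; rewrite en in i1 *; move: i1; rewrite /incident /other_end.
  by case: eqP => [<- //|_ /= /eqP <-].
have h1 : (t1 < n)%R.
  apply: contraT => h; move: Sn; rewrite (Sout n); last by left; lia.
  by case: (al).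
have h2 : (n < t2)%R.
  apply: contraT => h; move: Sn1; rewrite (Sout (n + 1)%R); last by right; lia.
  by case: (al).
have : f \in window x t1 `|t2 - t1|%N.
  rewrite -en (_ : n = t1 + (`|n - t1|%N)%:Z)%R; last by lia.
  by apply: in_window; lia.
by move/HK; rewrite ltnNge leK.
Qed.

(** * The doubled comb *)

(* Vertex [cpair x j] is the [j]-th vertex of the hair attached to the [x]-th vertex [cpair x 0] of
   the spine.  The edges [cpair (cpair x j) k] lead from [cpair x j] up the hair for [k = 0, 1],
   and along the spine for [j = 0] and [k = 2, 3]. *)
Definition comb_left := cfst.
Definition comb_right c :=
  if csnd c < 2 then cpair (cfst (cfst c)) (csnd (cfst c)).+1 else cpair (cfst (cfst c)).+1 0.
(** The bound on [z] keeps this decidable. It holds trivially for [j = 0], so the spine is present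
    for every [e]. *)
Definition alive e x j := ball j (fun z => ~~ universal e x z).
Definition comb_vert e v := (v == cpair (cfst v) (csnd v)) && alive e (cfst v) (csnd v).
Definition comb_edge e c :=
  let x := cfst (cfst c) in let j := csnd (cfst c) in let k := csnd c in
  (c == cpair (cpair x j) k) && (((k < 2) && alive e x j.+1) || [&& 1 < k, k < 4 & j == 0]).
(** The left end of an edge at [v] has code at most [v], the last component is at most 3, and
    [cpair] is monotone. *)
Definition comb_bound (e v : nat) := (cpair v 3).+1.

Notation comb_inc := (incident comb_left comb_right).
Notation comb_walk := (is_walk comb_left comb_right).
Notation comb_dst := (walk_end comb_left comb_right).

Lemma comb_leftE v k : comb_left (cpair v k) = v.
Proof. exact: cfstK. Qed.

Lemma comb_rightE x j k :
  comb_right (cpair (cpair x j) k) = if k < 2 then cpair x j.+1 else cpair x.+1 0.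
Proof. by rewrite /comb_right !cfstK !csndK. Qed.

Lemma comb_vertE e x j : comb_vert e (cpair x j) = alive e x j.
Proof. by rewrite /comb_vert cfstK csndK eqxx. Qed.

Lemma comb_edgeE e x j k : comb_edge e (cpair (cpair x j) k) =
  ((k < 2) && alive e x j.+1) || [&& 1 < k, k < 4 & j == 0].
Proof. by rewrite /comb_edge !cfstK !csndK eqxx. Qed.

Lemma comb_edgeP e c : comb_edge e c -> exists x j k, c = cpair (cpair x j) k.
Proof. by case/andP=> /eqP -> _; do 3 eexists. Qed.

Lemma alive_leq e x i j : i <= j -> alive e x j -> alive e x i.
Proof. by move=> le /ballP H; apply/ballP => z ltz; apply: H; exact: leq_trans le. Qed.

Lemma comb_edge_vert e c : comb_edge e c -> comb_vert e (comb_left c) /\ comb_vert e (comb_right c).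
Proof.
move=> Ec; have [x [j [k ec]]] := comb_edgeP Ec; move: Ec; rewrite ec comb_edgeE comb_leftE comb_rightE.
case/orP=> [/andP[-> a]|/and3P[k1 k2 /eqP->]]; first by rewrite !comb_vertE a (alive_leq _ a).
by rewrite ltnNge k1 /= !comb_vertE.
Qed.

Lemma comb_edge_bound e : edge_bound comb_left comb_right (comb_edge e) (comb_bound e).
Proof.
move=> w c Ec; have [x [j [k ec]]] := comb_edgeP Ec; move: Ec.
rewrite ec comb_edgeE /incident comb_leftE comb_rightE /comb_bound ltnS => H iw.
have k4 : k <= 3 by case/orP: H => [/andP[]|/and3P[]]; lia.
apply: leq_cpair => //; case/orP: iw => /eqP <- //.
case/orP: H => [/andP[-> _]|/and3P[k1 _ /eqP->]]; first exact: leq_cpair.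
by rewrite (leqNgt k) k1 /=; exact: leq_cpair.
Qed.

Definition comb_graph := coded_graph comb_edge_vert.

Lemma comb_uhc : uniformly_highly_computable comb_graph.
Proof.
have cU := computable_universal.
apply: (coded_uhc comb_edge_vert comb_edge_bound).
- by apply: computable2P; rewrite /comb_vert /alive; computes_tac.
- by apply: computable2P; rewrite /comb_edge /alive; computes_tac.
- exact: computable_cfst.
- by apply: computable1P; rewrite /comb_right; computes_tac.
- by apply: computable2P; rewrite /comb_bound; computes_tac.
Qed.

Lemma cpair_neqS x j : (cpair x j == cpair x j.+1) = false.
Proof. by rewrite cpair_eqE eqxx /=; lia. Qed.

Lemma hair_up x j k : k < 2 -> comb_inc (cpair (cpair x j) k) (cpair x j) /\
  other_end comb_left comb_right (cpair (cpair x j) k) (cpair x j) = cpair x j.+1.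
Proof. by move=> k2; rewrite /incident /other_end comb_leftE comb_rightE k2 eqxx. Qed.

Lemma hair_down x j k : k < 2 -> comb_inc (cpair (cpair x j) k) (cpair x j.+1) /\
  other_end comb_left comb_right (cpair (cpair x j) k) (cpair x j.+1) = cpair x j.
Proof. by move=> k2; rewrite /incident /other_end comb_leftE comb_rightE k2 eqxx orbT cpair_neqS. Qed.

Lemma spine_up x k : 1 < k -> comb_inc (cpair (cpair x 0) k) (cpair x 0) /\
  other_end comb_left comb_right (cpair (cpair x 0) k) (cpair x 0) = cpair x.+1 0.
Proof. by move=> k2; rewrite /incident /other_end comb_leftE comb_rightE ltnNge k2 eqxx. Qed.

Lemma spine_down x k : 1 < k -> comb_inc (cpair (cpair x 0) k) (cpair x.+1 0) /\
  other_end comb_left comb_right (cpair (cpair x 0) k) (cpair x.+1 0) = cpair x 0.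
Proof.
move=> k2; rewrite /incident /other_end comb_leftE comb_rightE ltnNge k2 eqxx orbT cpair_eqE.
by rewrite (_ : x == x.+1 = false) //; lia.
Qed.

Lemma comb_connected e : graph_connected (comb_graph e).
Proof.
apply: (@coded_connected _ _ _ _ comb_edge_vert e (cpair 0 0)) => u /andP[/eqP].
move: (cfst u) (csnd u) => x j ->; elim: j => [_|j IH aj].
  elim: x => [|x [p [wp Ep dp]]]; first by exists [::].
  have [i1 o1] := @spine_down x 2 isT.
  by exists (cpair (cpair x 0) 2 :: p); rewrite /= i1 o1 wp Ep dp comb_edgeE.
have [|p [wp Ep dp]] := IH; first exact: (alive_leq (leqnSn j) aj).
have [i1 o1] := @hair_down x j 0 isT.
by exists (cpair (cpair x j) 0 :: p); rewrite /= i1 o1 wp Ep dp comb_edgeE aj.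
Qed.

(** Up one of two parallel edges, around the rest of the hair, and down the other. The induction
    starts at height [z], above which no edges exist. *)
Lemma hair_trail e x j : (exists z, universal e x z) ->
  exists p, [/\ comb_walk (cpair x j) p, comb_dst (cpair x j) p = cpair x j, uniq p
    & forall c, c \in p <-> comb_edge e c /\ exists j' k, [/\ j <= j', k < 2 & c = cpair (cpair x j') k]].
Proof.
move=> [z Uz]; have nz j' : z < j' -> ~~ alive e x j'.
  by move=> lt; apply/negP => /ballP/(_ z lt); rewrite Uz.
have [n] : exists n, z <= j + n by exists z; rewrite leq_addl.
elim: n j => [|n IH] j lez.
  exists [::]; split=> // c; split=> // -[Ec [j' [k [lej k2 ec]]]].
  by move: Ec; rewrite ec comb_edgeE k2 (negbTE (nz _ _)) /=; lia.
have [|p [wp dp up mp]] := IH j.+1; first by rewrite addSnnS.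
case: (boolP (alive e x j.+1)) => [aj|na]; last first.
  exists [::]; split=> // c; split=> // -[Ec [j' [k [lej k2 ec]]]].
  move: Ec; rewrite ec comb_edgeE k2 /= ltnNge leq_eqVlt.
  case/orP=> [a|]; last by lia.
  by case/negP: na; apply: alive_leq a.
have [i0 o0] := @hair_up x j 0 isT.
have [i1 o1] := @hair_down x j 1 isT.
have np k : cpair (cpair x j) k \notin p.
  apply/negP => /mp[_ [j' [k' [lej _ /cpair_inj[/cpair_inj[_ e1] _]]]]].
  by move: lej; rewrite e1 ltnn.
exists (cpair (cpair x j) 0 :: rcons p (cpair (cpair x j) 1)); split.
- by rewrite /= i0 o0 -cats1 walk_cat wp dp /= i1.
- by rewrite /= o0 -cats1 dst_cat dp /= o1.
- by rewrite /= mem_rcons inE rcons_uniq (negbTE (np 0)) (negbTE (np 1)) up cpair_eqE /= andbF.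
- move=> c; rewrite inE mem_rcons inE; split.
    case/or3P=> [/eqP->|/eqP->|/mp[Ec [j' [k [lej k2 ec]]]]].
    + by rewrite comb_edgeE aj; split=> //; exists j, 0.
    + by rewrite comb_edgeE aj; split=> //; exists j, 1.
    + by split=> //; exists j', k; split=> //; exact: ltnW.
  case=> Ec [j' [k [lej k2 ec]]].
  move: lej; rewrite leq_eqVlt => /orP[/eqP ej|ltj].
    by rewrite ec ej !cpair_eqE !eqxx /=; move: k2; case: (k) => [|[|]].
  by apply/or3P; constructor 3; apply/mp; split=> //; exists j', k.
Qed.

(** From spine vertex [M + 1]: back along one spine edge, the closed trail already built at [M], the
    hair at [M], and forward along the parallel spine edge. *)
Lemma comb_trail e M : (forall x, exists z, universal e x z) ->
  exists p, [/\ comb_walk (cpair M 0) p, comb_dst (cpair M 0) p = cpair M 0, uniq p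
    & forall c, c \in p <-> comb_edge e c /\ cfst (cfst c) < M].
Proof.
move=> H; elim: M => [|M [p [wp dp up mp]]]; first by exists [::]; split=> // c; split=> // -[].
have [q [wq dq uq mq]] := hair_trail 0 (H M).
have [i0 o0] := @spine_down M 2 isT.
have [i1 o1] := @spine_up M 3 isT.
have np k : cpair (cpair M 0) k \notin p by apply/negP => /mp; rewrite !cfstK ltnn => -[].
have nq k : 1 < k -> cpair (cpair M 0) k \notin q.
  move=> k1; apply/negP => /mq[_ [j' [k' [_ k2 /cpair_inj[_ ek]]]]].
  by move: k2; rewrite -ek ltnNge k1.
exists (cpair (cpair M 0) 2 :: rcons (p ++ q) (cpair (cpair M 0) 3)); split.
- by rewrite /= i0 o0 -cats1 !walk_cat !dst_cat wp dp wq dq /= i1.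
- by rewrite /= o0 -cats1 !dst_cat dp dq /= o1.
- rewrite /= mem_rcons inE rcons_uniq !mem_cat !(negbTE (np _)) !(negbTE (nq _ _)) // cpair_eqE /= andbF /=.
  rewrite cat_uniq up uq andbT /=; apply/hasPn => c /mq[_ [j' [k [_ _ ->]]]].
  by apply/negP => /mp; rewrite !cfstK ltnn => -[].
- move=> c; rewrite inE mem_rcons inE mem_cat; split.
    case/or4P=> [/eqP->|/eqP->|/mp[Ec ltM]|/mq[Ec [j' [k [_ _ ec]]]]].
    + by rewrite comb_edgeE !cfstK.
    + by rewrite comb_edgeE !cfstK.
    + by split=> //; exact: ltnW.
    + by split=> //; rewrite ec !cfstK.
  case=> Ec; rewrite ltnS leq_eqVlt => /orP[/eqP eM|ltM]; last first.
    by apply/or4P; constructor 3; apply/mp.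
  have [x [j [k ec]]] := comb_edgeP Ec; have ex : x = M by rewrite -eM ec !cfstK.
  move: Ec; rewrite ec ex => Ec; move: (Ec); rewrite comb_edgeE => /orP[/andP[k2 _]|/and3P[k1 k4 /eqP ->]].
    by apply/or4P; constructor 4; apply/mq; split=> //; exists j, k.
  by rewrite !cpair_eqE !eqxx /=; move: k1 k4; case: (k) => [|[|[|[|]]]].
Qed.

Lemma comb_exhausted e : (forall x, exists z, universal e x z) ->
  exhausted comb_left comb_right (comb_edge e).
Proof.
(* [N.+1] instead of [N] keeps the trail nonempty for [N = 0]. *)
move=> H N; have [p [wp dp up mp]] := comb_trail N.+1 H.
exists (cpair N.+1 0), p.
have uns : unsat comb_left comb_right (comb_edge e) p (cpair N.+1 0).
  exists (cpair (cpair N.+1 0) 2); split; first by rewrite comb_edgeE.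
    exact: (spine_up _ _).1.
  by apply/negP => /mp; rewrite !cfstK ltnn => -[].
split; last first.
  move=> c ltc Ec; apply/mp; split=> //; have [x [j [k ec]]] := comb_edgeP Ec.
  rewrite ec !cfstK ltnS; apply: leq_trans (ltnW ltc); rewrite ec.
  exact: leq_trans (leq_cpairl _ _) (leq_cpairl _ _).
split; rewrite ?dp //.
- have : cpair (cpair 0 0) 2 \in p by apply/mp; rewrite comb_edgeE !cfstK.
  by case: (p).
- rewrite wp up andbT /=; apply/allP => c /mp[]//.
- move=> f w /mp[Ef fN] ifw [g [Eg igw /negP ng]].
  suff -> : w = cpair N.+1 0 by exists [::]; split=> //; left.
  have gN : N < cfst (cfst g) by rewrite ltnNge; apply/negP => h; apply: ng; apply/mp.
  have wN : N < cfst w.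
    have [x [j [k eg]]] := comb_edgeP Eg; move: igw gN; rewrite eg /incident comb_leftE comb_rightE !cfstK.
    by case/orP=> /eqP <-; [|case: ifP]; rewrite ?cfstK // => _; exact: leqW.
  have [x [j [k ef]]] := comb_edgeP Ef; move: ifw fN; rewrite ef /incident comb_leftE comb_rightE !cfstK.
  case/orP=> /eqP ew; first by move: wN; rewrite -ew cfstK => h1 h2; lia.
  move: ew; case: ifP => _ ew; move: wN; rewrite -ew cfstK => h1 h2; first by lia.
  by congr cpair; lia.
Qed.

Lemma comb_infinite_hair e x : (forall z, ~~ universal e x z) ->
  ~ exists v y : int -> nat, two_way_trail comb_left comb_right (comb_edge e) v y.
Proof.
move=> nU [v [y tr]]; have al j : alive e x j by apply/ballP.
(* The infinite hair without its base vertex; the two lowest edges of the hair form the cut. *)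
pose S w := [&& w == cpair (cfst w) (csnd w), cfst w == x & 0 < csnd w].
have SE x' j : S (cpair x' j) = (x' == x) && (0 < j) by rewrite /S cfstK csndK eqxx.
apply: (@two_way_two_cut _ _ _ _ _ S (cpair (cpair x 0) 0) (cpair (cpair x 0) 1) tr).
- by rewrite cpair_eqE andbF.
- by rewrite comb_edgeE al.
- by rewrite comb_edgeE al.
- move=> f Ef; have [x' [j [k ef]]] := comb_edgeP Ef; move: Ef; rewrite ef comb_edgeE comb_leftE comb_rightE SE !cpair_eqE.
  case/orP=> [/andP[k2 _]|/and3P[k1 k4 /eqP ->]].
    rewrite k2 SE andbT; case: (x' == x) => //=; case: (j) => [|i] //=.
    by move: k2; case: k {ef} => [|[|]].
  rewrite (ltnNge k) k1 /= SE !ltnn !andbF /=.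
  by move: k1; case: k {ef k4} => [|[|k]] //; rewrite !andbF.
(* Edges high up in the hair on one side, and far out on the spine on the other; [N.+1] keeps the
   hair edge off the base. *)
- move=> [] N.
    exists (cpair (cpair x N.+1) 0); rewrite comb_leftE comb_rightE !SE comb_edgeE al eqxx; split=> //.
    by apply: leq_trans (leq_cpairl _ _); apply: leq_trans (leq_cpairr _ _); exact: leqnSn.
  exists (cpair (cpair N 0) 2); rewrite comb_leftE comb_rightE !SE comb_edgeE !andbF; split=> //.
  exact: leq_trans (leq_cpairl _ _) (leq_cpairl _ _).
Qed.

Lemma comb_two_way e :
  has_two_way_eulerian_path (comb_graph e) <-> forall x, exists z, universal e x z.
Proof.
rewrite (coded_two_way comb_edge_vert); split=> [tr x|H].
  by apply: contrapT => nz; apply: (@comb_infinite_hair e x) tr => z; apply/negP => Uz; apply: nz; exists z.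
exact: two_way_of_exhausted (@comb_edge_bound e) (comb_exhausted H).
Qed.

Theorem theorem4p5 :
  (forall G : nat -> multigraph,
     uniformly_highly_computable G ->
     (forall e, graph_connected (G e)) ->
     (forall e, locally_finite (G e)) ->
     pi02 [set e | has_two_way_eulerian_path (G e)])
  /\
  (exists G : nat -> multigraph,
     [/\ uniformly_highly_computable G,
         (forall e, graph_connected (G e)),
         (forall e, locally_finite (G e)) &
         pi02_complete [set e | has_two_way_eulerian_path (G e)]]).
Proof.
split=> [G uhc _ _|]; first exact: pi02_two_way.
exists comb_graph; split; [exact: comb_uhc | exact: comb_connected | by case: comb_uhc |].
split; first exact: pi02_two_way comb_uhc.
(* The reduction pairs [n] with the fixed code of a program for [R], selecting the comb whose hairs
   search for witnesses of [R n]. *)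
move=> A [R [[p Hp] AR]]; exists (cpair (code p)); split.
  by apply: computable1P; apply: (@computes_cpair _ _ (fun=> code p) id); computes_tac.
move=> n; rewrite AR /= comb_two_way.
have HU x := universalP (Hp n x).
by split=> H x; apply/HU; exact: H.
Qed.
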